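(* (i) For the component of type $C(n+1)$ (with $n\ge1$), the group $\mathrm{Sp}^D(v)$ is trivial. (ii) For the component of type $C(n+1)^{(1)}$ with $n>1$, let $\Psi$ be the restriction of $(s_{\varepsilon_1}s_{\delta-2\varepsilon_1})^2$ to $V_b$. The group $\mathrm{Sp}^D(v)$ is an infinite cyclic group generated by an element $u$ with $\sigma_b^u=\Psi$ and $\sigma^u(v_i)=v_{i+4n}$ for all $i\in\mathbb Z$.
   Context: All vector spaces are over $\mathbb C$. Fix a finite set $X$. A root datum is $v=(\mathfrak h,a,b,p)$ with $\mathfrak h$ a finite-dimensional vector space, $a:X\to\mathfrak h$ and $b:X\to\mathfrak h^*$ maps whose values form linearly independent families, and $p:X\to\mathbb Z_2$. Write $a_v,b_v,p_v$ for these maps. The Cartan matrix is $A^v=(a^v_{xy})$, $a^v_{xy}=\langle a_v(x),b_v(y)\rangle$; $(A^v,p_v)$ is the Cartan datum at $v$. An element $x\in X$ is reflectable at $v$ if either $a_{xx}=0$, $p(x)=\bar1$; or $a_{xx}\ne0$, $p(x)=\bar0$ and $2a_{xy}/a_{xx}\in\mathbb Z_{\le0}$ for all $y\ne x$; or $a_{xx}\ne0$, $p(x)=\bar1$ and $a_{xy}/a_{xx}\in\mathbb Z_{\le0}$ for all $y\ne x$. For such $x$ the reflexion $r_x:v\to v'=(\mathfrak h,a',b',p')$ is: if $a_{xx}\neq0$ (anisotropic reflexion), $p'=p$, $a'(y)=a(y)-2\frac{a_{yx}}{a_{xx}}a(x)$, $b'(y)=b(y)-2\frac{a_{xy}}{a_{xx}}b(x)$;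 if $a_{xx}=0$ (isotropic reflexion), $(a',b',p')(x)=(-a(x),-b(x),p(x))$, and for $y\ne x$: $(a',b',p')(y)=(a(y),b(y),p(y))$ if $a_{xy}=0$, $(a',b',p')(y)=(a(y)+\frac{a_{yx}}{a_{xy}}a(x),\,b(y)+b(x),\,p(y)+\bar1)$ if $a_{xy}\ne0$. The skeleton $\mathrm{Sk}(v)$ (resp. the spine $\mathrm{Sp}(v)$) is the set of root data obtained from $v$ by finite sequences of reflexions (resp. isotropic reflexions), viewed as a graph with edges $u\leftrightarrow r_x(u)$ marked by $r_x$. $V_b\subset\mathfrak h^*$ is the span of $\{b_v(x)\}_{x\in X}$. For $u\in\mathrm{Sk}(v)$ define $\sigma_b^u\in GL(V_b)$ by $\sigma_b^u(b_v(x))=b_u(x)$, $x\in X$. Two Cartan data $(A,p),(A',p')$ are $D$-equivalent if $p=p'$ and $A=DA'$ for an invertible diagonal matrix $D$. $\mathrm{Sk}^D(v)$ is the set of $u\in\mathrm{Sk}(v)$ whose Cartan datum is $D$-equivalent to that of $v$, and $\mathrm{Sp}^D(v)=\mathrm{Sk}^D(v)\cap\mathrm{Sp}(v)$. For $v'\in\mathrm{Sk}^D(v)$ and $u\in\mathrm{Sk}(v)$ choose a path from $v$ to $u$; there is a unique path starting at $v'$ with the same sequence of marks, and its endpoint $\sigma^{v'}(u)$ does not depend on the chosen path. The group operation on $\mathrm{Sk}^D(v)$ (and on its subgroup $\mathrm{Sp}^D(v)$) is $u_1*u_2:=\sigma^{u_1}(u_2)$, with unit $v$. Type $C(n+1)$: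 $X=\{x_1,\dots,x_{n+1}\}$, $\mathfrak h^*$ has basis $\varepsilon_1,\delta_1,\dots,\delta_n$ with symmetric bilinear form $(\varepsilon_1,\varepsilon_1)=1$, $(\delta_i,\delta_j)=-\delta_{ij}$, $(\varepsilon_1,\delta_i)=0$; the component contains the vertex $v_0$ with ordered simple roots $(b_{v_0}(x_1),\dots,b_{v_0}(x_{n+1}))=(\delta_1-\delta_2,\dots,\delta_{n-1}-\delta_n,\delta_n-\varepsilon_1,\delta_n+\varepsilon_1)$, with Cartan matrix the Gram matrix of these roots, the last two roots being odd and the others even; $v$ is any vertex of $\mathrm{Sp}(v_0)$. Type $C(n+1)^{(1)}$, $n>1$: $X=\{x_0,\dots,x_{n+1}\}$, $\mathfrak h^*$ has basis $\varepsilon_1,\delta_1,\dots,\delta_n,\delta,\Lambda_0$ with a nondegenerate symmetric bilinear form satisfying $(\varepsilon_1,\varepsilon_1)=1$, $(\delta_i,\delta_j)=-\delta_{ij}$, $(\varepsilon_1,\delta_i)=0$ for $i,j=1,\dots,n$ and $(\delta,\delta)=(\delta,\varepsilon_1)=(\delta,\delta_i)=0$; the component contains $v_0$ with ordered simple roots $(b_{v_0}(x_0),\dots,b_{v_0}(x_{n+1}))=(\delta-2\delta_1,\delta_1-\delta_2,\dots,\delta_{n-1}-\delta_n,\delta_n-\varepsilon_1,\delta_n+\varepsilon_1)$, Cartan matrix the Gram matrix, the last two roots being odd and the others even; $v$ is any vertex of $\mathrm{Sp}(v_0)$. The spine is a bi-infinite line graph with consecutive vertices $(v_i)_{i\in\mathbb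 Z}$, indexed so that $v_1=r_{x_{n+1}}(v_0)$ and $v_{-1}=r_{x_n}(v_0)$. For $\mu\in\mathfrak h^*$ with $(\mu,\mu)\ne0$, $s_\mu(\nu)=\nu-\frac{2(\nu,\mu)}{(\mu,\mu)}\mu$. *)

(* Defs.v *)
From HB Require Import structures.
From mathcomp Require Import all_boot all_order all_algebra sesquilinear.
From mathcomp Require Import boolp classical_sets functions cardinality reals.
From mathcomp Require Import complex.

Set Implicit Arguments.
Unset Strict Implicit.
Unset Printing Implicit Defensive.

Import GRing.Theory.
Local Open Scope ring_scope.
Local Open Scope classical_set_scope.

Notation dual K h := 'Hom(h, K^o).

Section Groups.
Variables (T : Type) (op : T -> T -> T) (e : T).
Implicit Types G H : set T.

Definition is_group G : Prop :=
  [/\ G e,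
      forall x y, G x -> G y -> G (op x y),
      forall x y z, G x -> G y -> G z -> op x (op y z) = op (op x y) z,
      forall x, G x -> op e x = x /\ op x e = x
    & forall x, G x -> exists y, [/\ G y, op x y = e & op y x = e]].

Definition trivial_group G : Prop := is_group G /\ G = [set e].

Definition is_subgroup H G : Prop :=
  [/\ H `<=` G, H e,
      forall x y, H x -> H y -> H (op x y)
    & forall x y, H x -> G y -> op x y = e -> H y].

Definition infinite_cyclic_group_gen G (u : T) : Prop :=
  [/\ is_group G, infinite_set G, G u
    & forall H, is_subgroup H G -> H u -> H = G].

End Groups.

Section FreeFamilies.
Variables (K : fieldType) (V : vectType K) (X : finType).

Lemma free_codomP (f : {ffun X -> V}) :
  reflect (forall c : X -> K, \sum_x c x *: f x = 0 -> forall x, c x = 0)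
          (free (codom f)).
Proof.
have E (c : X -> K) : \sum_(i < #|X|) c (enum_val i) *: (codom_tuple f)`_i
                      = \sum_x c x *: f x.
  have -> : \sum_x c x *: f x = \sum_(x in X) c x *: f x by exact: eq_bigl.
  rewrite [RHS]big_enum_val /=; apply: eq_bigr => i _; congr (_ *: _).
  by rewrite (nth_map (enum_val i)) -?cardE // -enum_val_nth.
have P := @freeP K V _ (codom_tuple f).
apply: (iffP P) => H c.
  move=> s0 x; have := H (c \o enum_val); rewrite /= E => /(_ s0 (enum_rank x)).
  by rewrite enum_rankK.
move=> s0 i; rewrite -(enum_valK i); apply: (H (c \o enum_rank)).
by rewrite -E -[RHS]s0; apply: eq_bigr => j _ /=; rewrite enum_valK.
Qed.

Lemma free_codom_transvect (x : X) (k : X -> K) (f g : {ffun X -> V}) :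
    g x = - f x -> (forall y, y != x -> g y = f y + k y *: f x) ->
  free (codom f) -> free (codom g).
Proof.
move=> gx gy /free_codomP fF; apply/free_codomP => c.
rewrite (bigD1 x) //= gx.
under eq_bigr => y yx do rewrite gy // scalerDr scalerA.
rewrite big_split /= -scaler_suml addrCA scalerN -scaleNr -scalerDl => s0.
pose d y := if y == x then - c x + \sum_(i | i != x) c i * k i else c y.
have dF : forall y, d y = 0.
  apply: fF; rewrite (bigD1 x) //= /d eqxx -[RHS]s0 addrC; congr (_ + _).
  by apply: eq_bigr => y /negPf ->.
have cN y : y != x -> c y = 0 by move=> /negPf yx; have := dF y; rewrite /d yx.
move=> y; have [->|/cN //] := eqVneq y x.
have := dF x; rewrite /d eqxx big1 ?addr0; last by move=> i /cN ->; rewrite mul0r.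
by move/eqP; rewrite oppr_eq0 => /eqP.
Qed.

End FreeFamilies.

Section RootData.
Variables (K : fieldType) (X : finType) (h : vectType K).

Record root_datum := RootDatum {
  rd_a : {ffun X -> h};
  rd_b : {ffun X -> dual K h};
  rd_p : {ffun X -> 'Z_2};
  rd_a_free : free (codom rd_a);
  rd_b_free : free (codom rd_b) }.

Implicit Types (u v w : root_datum) (x y : X) (s : seq X).

Definition cartan v x y : K := rd_b v y (rd_a v x).

Definition nonpos_int (z : K) : Prop := exists k : nat, z = - k%:R.

Definition reflectable v x : Prop :=
  [\/ cartan v x x = 0 /\ rd_p v x = 1,
      [/\ cartan v x x <> 0, rd_p v x = 0
        & forall y, y != x -> nonpos_int (2 * cartan v x y / cartan v x x)]
    | [/\ cartan v x x <> 0, rd_p v x = 1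
        & forall y, y != x -> nonpos_int (cartan v x y / cartan v x x)]].

Definition isotropic v x : Prop := reflectable v x /\ cartan v x x = 0.

Definition reflexion_a x v : {ffun X -> h} := [ffun y =>
  if cartan v x x != 0 then
    rd_a v y - (2 * (cartan v y x / cartan v x x)) *: rd_a v x
  else if y == x then - rd_a v x
  else if cartan v x y == 0 then rd_a v y
  else rd_a v y + (cartan v y x / cartan v x y) *: rd_a v x].

Definition reflexion_b x v : {ffun X -> dual K h} := [ffun y =>
  if cartan v x x != 0 then
    rd_b v y - (2 * (cartan v x y / cartan v x x)) *: rd_b v x
  else if y == x then - rd_b v x
  else if cartan v x y == 0 then rd_b v y
  else rd_b v y + rd_b v x].

Definition reflexion_p x v : {ffun X -> 'Z_2} := [ffun y =>
  if cartan v x x != 0 then rd_p v y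
  else if y == x then rd_p v x
  else if cartan v x y == 0 then rd_p v y
  else rd_p v y + 1].

Lemma reflexion_a_free x v : free (codom (reflexion_a x v)).
Proof.
pose k y := if cartan v x x != 0 then - (2 * (cartan v y x / cartan v x x))
  else if cartan v x y == 0 then 0 else cartan v y x / cartan v x y.
apply: (@free_codom_transvect _ _ _ x k (rd_a v)); last exact: rd_a_free.
  rewrite ffunE eqxx; case: ifP => // a0; rewrite divff // mulr1.
  by rewrite scaler_nat mulr2n opprD addrA subrr add0r.
move=> y /negPf yx; rewrite ffunE yx /k; case: ifP => _; first by rewrite scaleNr.
by case: ifP => _ //; rewrite scale0r addr0.
Qed.

Lemma reflexion_b_free x v : free (codom (reflexion_b x v)).
Proof.
pose k y := if cartan v x x != 0 then - (2 * (cartan v x y / cartan v x x))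
  else if cartan v x y == 0 then 0 else 1.
apply: (@free_codom_transvect _ _ _ x k (rd_b v)); last exact: rd_b_free.
  rewrite ffunE eqxx; case: ifP => // a0; rewrite divff // mulr1.
  by rewrite scaler_nat mulr2n opprD addrA subrr add0r.
move=> y /negPf yx; rewrite ffunE yx /k; case: ifP => _; first by rewrite scaleNr.
by case: ifP => _; rewrite ?scale0r ?addr0 ?scale1r.
Qed.

(* Total in [x]; it is the reflexion r_x when [x] is reflectable at [v]. *)
Definition reflexion x v : root_datum :=
  @RootDatum _ _ (reflexion_p x v) (reflexion_a_free x v) (reflexion_b_free x v).

Fixpoint walk v s : root_datum :=
  if s is x :: s' then walk (reflexion x v) s' else v.

Fixpoint all_along (P : root_datum -> X -> Prop) v s : Prop :=
  if s is x :: s' then P v x /\ all_along P (reflexion x v) s' else True.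

Definition skeleton v : set root_datum :=
  [set u | exists s, all_along reflectable v s /\ walk v s = u].

Definition spine v : set root_datum :=
  [set u | exists s, all_along isotropic v s /\ walk v s = u].

Definition spine_edge u w : Prop := exists x, isotropic u x /\ w = reflexion x u.

Definition D_equivalent u v : Prop :=
  rd_p u = rd_p v /\
  exists d : X -> K, (forall x, d x != 0) /\
    forall x y, cartan u x y = d x * cartan v x y.

Definition skeletonD v : set root_datum :=
  skeleton v `&` [set u | D_equivalent u v].

Definition spineD v : set root_datum := skeletonD v `&` spine v.

(* A chosen sequence of marks of a path in the skeleton from [v] to [u]
   (junk value [::] if there is none). *)
Definition path_to v u : seq X :=
  xget [::] [set s | all_along reflectable v s /\ walk v s = u].

(* sigma^{v'}(u), relative to the base point [v] *)
Definition sigma v v' u : root_datum := walk v' (path_to v u).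

Definition sk_op v u1 u2 : root_datum := sigma v u1 u2.

Definition Vb v : {vspace dual K h} := <<codom (rd_b v)>>%VS.

(* On [Vb v] this is the linear map sending [rd_b v x] to [rd_b u x];
   [coord] is only meaningful on [Vb v]. *)
Definition sigma_b v u (w : dual K h) : dual K h :=
  \sum_x coord (codom_tuple (rd_b v)) (enum_rank x) w *: rd_b u x.

Definition spine_indexed_by v (vs : int -> root_datum) : Prop :=
  [/\ injective vs, range vs = spine v
    & forall i j : int, spine_edge (vs i) (vs j) <-> `|i - j| = 1].

End RootData.

Section OrthogonalReflection.
Variables (K : fieldType) (V : vectType K) (form : {symmetric V}).

Definition s_ (mu nu : V) : V := nu - (2 * form nu mu / form mu mu) *: mu.

End OrthogonalReflection.

Section Types.
Variables (K : fieldType) (h : vectType K) (form : {symmetric (dual K h)}).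
Variables (n : nat) (eps : dual K h) (dl : nat -> dual K h).

(* delta_1, ..., delta_n; the other values of [dl] are irrelevant. *)
Definition delta_seq : seq (dual K h) := [seq dl i | i <- iota 1 n].

Definition eps_delta_gram : Prop :=
  [/\ form eps eps = 1,
      forall i j, (1 <= i <= n)%N -> (1 <= j <= n)%N ->
        form (dl i) (dl j) = - (i == j)%:R
    & forall i, (1 <= i <= n)%N -> form eps (dl i) = 0].

Definition C_root (k : nat) : dual K h :=
  if (k < n)%N then dl k - dl k.+1
  else if k == n then dl n - eps
  else dl n + eps.

Definition C_parity (k : nat) : 'Z_2 := if (k < n)%N then 0 else 1.

Definition gram_cartan (X : finType) (v : root_datum X h) : Prop :=
  forall x y, cartan v x y = form (rd_b v x) (rd_b v y).

(* X = {x_1, ..., x_(n+1)}, with x_k encoded as the ordinal k - 1. *)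
Definition type_C (v0 : root_datum 'I_n.+1 h) : Prop :=
  [/\ basis_of fullv (eps :: delta_seq), eps_delta_gram,
      forall i, rd_b v0 i = C_root i.+1,
      forall i, rd_p v0 i = C_parity i.+1
    & gram_cartan v0].

(* X = {x_0, ..., x_(n+1)}, with x_k encoded as the ordinal k. *)
Definition type_C1 (d L0 : dual K h) (v0 : root_datum 'I_n.+2 h) : Prop :=
  [/\ basis_of fullv (eps :: delta_seq ++ [:: d; L0]),
      nondegenerate form,
      eps_delta_gram /\
        [/\ form d d = 0, form d eps = 0
          & forall i, (1 <= i <= n)%N -> form d (dl i) = 0],
      forall i, rd_b v0 i = if i == 0%N :> nat then d - 2 *: dl 1%N else C_root i
    & (forall i, rd_p v0 i = C_parity i) /\ gram_cartan v0].

End Types.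

(* Main.v *)
From HB Require Import structures.
Require Import Defs.
From mathcomp Require Import all_boot all_order all_algebra sesquilinear.
From mathcomp Require Import boolp classical_sets functions cardinality reals.
From mathcomp Require Import complex.
From mathcomp Require Import zify ring.

(* A D-equivalence between two vertices extends to linear maps carrying one root datum to the
   other, and these maps follow every sequence of reflexions; hence [sigma] does not depend on
   the path and Sp^D(v) is a group.

   Up to a relabelling, every vertex of the two spines has simple roots S_j - S_(j+1), where S
   is the sequence (delta - delta_1, delta_1, ..., delta_n, - delta_n), without its first term
   in the finite type, in which a vector e = +-(eps + k delta) has been inserted.  Only the one
   or two simple roots involving e are isotropic, and the isotropic reflexions move e one step
   in the sequence.  When e reaches the next-to-last place, exchanging the last two labels and
   replacing e by - e describes the same vertex; when e is in second place in the affine type,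
   exchanging the first two labels and replacing e by delta - e does.  So the finite spine is a
   segment, and in the affine one, after four passages of n steps, the labels return to their
   initial state while eps has become eps + 2 delta, which is the effect of Psi.  The Cartan
   matrix up to D-equivalence determines the labels, through the long simple root at each end,
   and the parity then determines the place of e. *)

Set Implicit Arguments.
Unset Strict Implicit.
Unset Printing Implicit Defensive.

Import GRing.Theory.
Local Open Scope ring_scope.
Local Open Scope classical_set_scope.

(** * Walks, D-equivalence and the group structure, for arbitrary root data *)

Lemma linear_extension (K : fieldType) (V : vectType K) (W : lmodType K)
    (X : finType) (f : {ffun X -> V}) (g : X -> W) :
  free (codom f) -> exists phi : {linear V -> W}, forall x, phi (f x) = g x.
Proof.
have [phi phiP] := linear_of_free (codom f) [seq g x | x <- enum X].
move=> ff; exists phi => x; have := phiP ff.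
rewrite size_map size_codom cardE => /(_ erefl).
rewrite codomE -map_comp => /eq_in_map; apply.
by rewrite mem_enum.
Qed.

Section Walks.
Variables (K : fieldType) (X : finType) (h : vectType K).
Implicit Types (u v w : root_datum X h) (x y z : X) (s : seq X).

Lemma root_datum_ext u v :
  rd_a u =1 rd_a v -> rd_b u =1 rd_b v -> rd_p u =1 rd_p v -> u = v.
Proof.
case: u v => [a b p fa fb] [a' b' p' fa' fb'] /= /ffunP aa /ffunP bb /ffunP pp.
subst a' b' p'.
by rewrite (bool_irrelevance fa fa') (bool_irrelevance fb fb').
Qed.

Lemma walk_cat v s t : walk v (s ++ t) = walk (walk v s) t.
Proof. by elim: s v => //= x s IH v. Qed.

Lemma all_along_cat (P : root_datum X h -> X -> Prop) v s t :
  all_along P v (s ++ t) <-> all_along P v s /\ all_along P (walk v s) t.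
Proof. by elim: s v => [|x s IH] v /=; [|rewrite IH]; tauto. Qed.

Lemma isotropic_reflectable v s :
  all_along (@isotropic K X h) v s -> all_along (@reflectable K X h) v s.
Proof. by elim: s v => //= x s IH v [[? ?] /IH]. Qed.

Lemma spine_refl v : spine v v.
Proof. by exists [::]. Qed.

Lemma spine_trans u v w : spine u v -> spine v w -> spine u w.
Proof.
move=> [s [us <-]] [t [vt <-]]; exists (s ++ t).
by rewrite all_along_cat walk_cat.
Qed.

Lemma spine_step v x : isotropic v x -> spine v (reflexion x v).
Proof. by exists [:: x]. Qed.

Lemma spine_skeleton u v : spine u v -> skeleton u v.
Proof. by move=> [s [us <-]]; exists s; split=> //; apply: isotropic_reflectable. Qed.

Lemma spine_ind v (P : root_datum X h -> Prop) : P v ->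
  (forall u x, spine v u -> P u -> isotropic u x -> P (reflexion x u)) ->
  forall u, spine v u -> P u.
Proof.
move=> Pv PS u [s [vs <-]].
suff {vs} W w : spine v w -> P w -> all_along (@isotropic K X h) w s ->
  P (walk w s) by apply: W vs => //; apply: spine_refl.
elim: s w => //= x s IH w vw Pw [wx ws].
apply: IH => //; last exact: PS.
exact: spine_trans vw (spine_step wx).
Qed.

(* Both kinds of reflexion add multiples of [rd_a v x] and [rd_b v x], at [x] itself as well. *)
Definition coef_a v x y : K :=
  if cartan v x x != 0 then - (2 * (cartan v y x / cartan v x x))
  else if y == x then - 2
  else if cartan v x y == 0 then 0 else cartan v y x / cartan v x y.

Definition coef_b v x y : K :=
  if cartan v x x != 0 then - (2 * (cartan v x y / cartan v x x))
  else if y == x then - 2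
  else if cartan v x y == 0 then 0 else 1.

Lemma reflexion_aE v x y :
  rd_a (reflexion x v) y = rd_a v y + coef_a v x y *: rd_a v x.
Proof.
rewrite /= ffunE /coef_a; case: ifP => _; first by rewrite scaleNr.
case: eqP => [->|_]; first by rewrite scaleNr scaler_nat opprD addrA subrr add0r.
by case: ifP => _; rewrite ?scale0r ?addr0.
Qed.

Lemma reflexion_bE v x y :
  rd_b (reflexion x v) y = rd_b v y + coef_b v x y *: rd_b v x.
Proof.
rewrite /= ffunE /coef_b; case: ifP => _; first by rewrite scaleNr.
case: eqP => [->|_]; first by rewrite scaleNr scaler_nat opprD addrA subrr add0r.
by case: ifP => _; rewrite ?scale0r ?addr0 ?scale1r.
Qed.

Lemma cartan_reflexion v x y z : cartan (reflexion x v) y z =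
  cartan v y z + coef_b v x z * cartan v y x
  + coef_a v x y * (cartan v x z + coef_b v x z * cartan v x x).
Proof.
rewrite {1}/cartan reflexion_aE reflexion_bE linearD linearZ /=.
by rewrite !add_lfunE !scale_lfunE.
Qed.

Lemma isotropicE v x : isotropic v x <-> cartan v x x = 0 /\ rd_p v x = 1.
Proof.
split=> [[vx x0]|[x0 px]]; last by split=> //; apply: Or31.
by case: vx => [//|[]|[]]; rewrite x0.
Qed.

Lemma isotropic_reflexion v x : isotropic v x -> isotropic (reflexion x v) x.
Proof.
move=> /isotropicE[x0 px]; apply/isotropicE; split.
  by rewrite cartan_reflexion x0 !(mulr0, addr0).
by rewrite /= ffunE x0 !eqxx.
Qed.

(** The first reflexion negates row and column [x] of the Cartan matrix, so the second one has the
    same coefficients but uses the opposite vectors; parities are shifted twice in Z_2. *)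
Lemma reflexionK v x : isotropic v x -> reflexion x (reflexion x v) = v.
Proof.
move=> /isotropicE[x0 px].
have rx0 : cartan (reflexion x v) x x = 0.
  by rewrite cartan_reflexion x0 !(mulr0, addr0).
have ax : coef_a v x x = -2 by rewrite /coef_a x0 !eqxx.
have bx : coef_b v x x = -2 by rewrite /coef_b x0 !eqxx.
have r0 y : cartan (reflexion x v) x y = - cartan v x y.
  rewrite cartan_reflexion ax x0; ring.
have r0' y : cartan (reflexion x v) y x = - cartan v y x.
  rewrite cartan_reflexion bx x0; ring.
have ra y : coef_a (reflexion x v) x y = coef_a v x y.
  by rewrite /coef_a rx0 x0 eqxx /= r0 r0' oppr_eq0 invrN mulrNN.
have rb y : coef_b (reflexion x v) x y = coef_b v x y.
  by rewrite /coef_b rx0 x0 eqxx /= r0 oppr_eq0.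
have N2 : 1 + -2 = -1 :> K by ring.
apply: root_datum_ext => y.
- rewrite !reflexion_aE ra ax -addrA -{2}[rd_a v x]scale1r -scalerDl N2 scaleN1r.
  by rewrite scalerN subrr addr0.
- rewrite !reflexion_bE rb bx -addrA -{2}[rd_b v x]scale1r -scalerDl N2 scaleN1r.
  by rewrite scalerN subrr addr0.
rewrite /= ffunE rx0 eqxx /= r0 oppr_eq0 !ffunE x0 !eqxx /=.
case: eqP => [->//|_]; case: eqP => // _.
by rewrite -addrA [1 + 1](_ : _ = 0) ?addr0 //; apply/val_inj.
Qed.

Lemma spine_sym u v : spine u v -> spine v u.
Proof.
move: v; apply: spine_ind; first exact: spine_refl.
move=> v x _ vu vx; apply: spine_trans vu.
by rewrite -{2}(reflexionK vx); apply/spine_step/isotropic_reflexion.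
Qed.

(* [f] and [g] carry [a_u] and [b_u] to [a_v] and [b_v], up to the scalars [d] of a
   D-equivalence; both kinds of reflexions preserve such a relation. *)
Definition intertwined (d : X -> K) (f : {linear h -> h})
    (g : {linear (dual K h) -> (dual K h)}) u v : Prop :=
  [/\ forall x, d x != 0,
      forall x, rd_a v x = d x *: f (rd_a u x),
      forall x, rd_b v x = g (rd_b u x),
      rd_p v = rd_p u
    & forall x y, cartan v x y = d x * cartan u x y].

(** [coef_b] is built from ratios within one row of the Cartan matrix, so it ignores the scalars
    [d]; [coef_a] gets multiplied by [d y / d x], which matches the rescaling of the vectors [a]. *)
Lemma intertwined_reflexion d f g u v x :
  intertwined d f g u v -> intertwined d f g (reflexion x u) (reflexion x v).
Proof.
move=> [d0 aE bE pE cE].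
have ka y : coef_a v x y * d x = d y * coef_a u x y.
  rewrite /coef_a !cE mulf_eq0 (negPf (d0 x)) /= mulf_eq0 (negPf (d0 x)) /=.
  case: ifP => [xx|_]; first by field; rewrite xx d0.
  case: eqP => [->|_]; first by rewrite mulrC.
  by case: ifP => [_|/negbT xy]; [rewrite mul0r mulr0 | field; rewrite xy d0].
have kb y : coef_b v x y = coef_b u x y.
  rewrite /coef_b !cE mulf_eq0 (negPf (d0 x)) /= mulf_eq0 (negPf (d0 x)) /=.
  by case: ifP => [xx|//]; field; rewrite xx d0.
split=> //.
- move=> y; rewrite !reflexion_aE !aE [f (_ + _)]linearD [f (_ *: _)]linearZ /=.
  by rewrite scalerDr !scalerA ka.
- by move=> y; rewrite !reflexion_bE !bE [g (_ + _)]linearD [g (_ *: _)]linearZ kb.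
- apply/ffunP => y; rewrite /= !ffunE pE !cE.
  by rewrite mulf_eq0 (negPf (d0 x)) /= mulf_eq0 (negPf (d0 x)).
move=> y z; rewrite !cartan_reflexion !cE kb.
rewrite [_ * (d x * _ + _)](_ : _ = coef_a v x y * d x *
  (cartan u x z + coef_b u x z * cartan u x x)); last by ring.
rewrite ka; ring.
Qed.

Lemma intertwined_walk d f g u v s :
  intertwined d f g u v -> intertwined d f g (walk u s) (walk v s).
Proof. by elim: s u v => //= x s IH u v uv; apply/IH/intertwined_reflexion. Qed.

Lemma intertwined_reflectable d f g u v x :
  intertwined d f g u v -> reflectable u x -> reflectable v x.
Proof.
move=> [d0 aE bE pE cE]; have dx := d0 x.
case=> [[x0 px]|[/eqP xx px H]|[/eqP xx px H]]; rewrite /reflectable pE !cE.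
- by apply: Or31; rewrite x0 mulr0.
- have xx' : d x * cartan u x x != 0 by rewrite mulf_neq0.
  apply: Or32; split=> //; first exact/eqP.
  move=> y /H [k kE]; exists k; rewrite -kE cE; field; by rewrite xx dx.
- have xx' : d x * cartan u x x != 0 by rewrite mulf_neq0.
  apply: Or33; split=> //; first exact/eqP.
  move=> y /H [k kE]; exists k; rewrite -kE cE; field; by rewrite xx dx.
Qed.

Lemma intertwined_isotropic d f g u v x :
  intertwined d f g u v -> isotropic u x -> isotropic v x.
Proof.
move=> uv [ux x0]; split; first exact: intertwined_reflectable uv ux.
by case: uv => _ _ _ _ ->; rewrite x0 mulr0.
Qed.

Lemma intertwined_along (P : root_datum X h -> X -> Prop) d f g u v s :
  (forall u' v' x, intertwined d f g u' v' -> P u' x -> P v' x) ->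
  intertwined d f g u v -> all_along P u s -> all_along P v s.
Proof.
move=> PP; elim: s u v => //= x s IH u v uv [ux us]; split; first exact: PP uv ux.
by apply: IH us; apply: intertwined_reflexion.
Qed.

Lemma intertwined_D d f g u v : intertwined d f g u v -> D_equivalent v u.
Proof. by move=> [d0 _ _ pE cE]; split=> //; exists d. Qed.

Lemma D_equivalent_intertwined u v :
  D_equivalent v u -> exists d f g, intertwined d f g u v.
Proof.
move=> [pE [d [d0 cE]]]; exists d.
have [g gE] := linear_extension (rd_b v) (rd_b_free u).
have [f fE] := linear_extension (fun x => (d x)^-1 *: rd_a v x)
  (rd_a_free u).
by exists f, g; split=> // x; rewrite fE scalerA mulfV // scale1r.
Qed.

Lemma D_equivalent_refl u : D_equivalent u u.
Proof. by split=> //; exists (fun=> 1); split=> *; rewrite ?oner_neq0 ?mul1r. Qed.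

Lemma D_equivalent_sym u v : D_equivalent u v -> D_equivalent v u.
Proof.
move=> [pE [d [d0 cE]]]; split=> //; exists (fun x => (d x)^-1).
by split=> [x|x y]; rewrite ?invr_eq0 // cE mulKf.
Qed.

Lemma D_equivalent_trans u v w :
  D_equivalent u v -> D_equivalent v w -> D_equivalent u w.
Proof.
move=> [pE [d [d0 cE]]] [pE' [d' [d0' cE']]]; split; first by rewrite pE.
exists (fun x => d x * d' x).
by split=> [x|x y]; rewrite ?mulf_neq0 // cE cE' mulrA.
Qed.

Lemma intertwined_walk_eq d f g u v s t :
  intertwined d f g u v -> walk u s = walk u t -> walk v s = walk v t.
Proof.
move=> uv at_index.
have [_ a1 b1 p1 _] := intertwined_walk s uv.
have [_ a2 b2 p2 _] := intertwined_walk t uv.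
by apply: root_datum_ext => x; rewrite ?a1 ?a2 ?b1 ?b2 ?p1 ?p2 at_index.
Qed.

(** The path chosen by [path_to] and the path [s] have the same end when started at [v];
    intertwining carries this coincidence over to [v']. *)
Lemma sigma_walk v v' s : D_equivalent v' v ->
  all_along (@reflectable K X h) v s -> sigma v v' (walk v s) = walk v' s.
Proof.
move=> /D_equivalent_intertwined [d [f [g vv']]] vs; rewrite /sigma.
apply: (intertwined_walk_eq vv').
by have [_ ->] := @xgetPex _ [::] [set t | all_along (@reflectable K X h) v t /\
  walk v t = walk v s] (ex_intro _ s (conj vs erefl)).
Qed.

Lemma spineDP v u : spineD v u <-> spine v u /\ D_equivalent u v.
Proof.
split=> [[[_ uD] uS]|[uS uD]]; first by split.
by split=> //; split=> //; apply: spine_skeleton.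
Qed.

(** The product of [u] and [walk v s] is [walk u s], so associativity is concatenation of paths, and
    the inverse of [x] is reached from [v] by the marks of a path from [x] back to [v]. *)
Lemma spineD_group v : is_group (sk_op v) v (spineD v).
Proof.
have opE u s : spineD v u -> all_along (@isotropic K X h) v s ->
    sk_op v u (walk v s) = walk u s.
  move=> /spineDP[_ uv] vs; apply: sigma_walk => //.
  exact: isotropic_reflectable.
have along u s : spineD v u -> all_along (@isotropic K X h) v s ->
    all_along (@isotropic K X h) u s.
  move=> /spineDP[_ /D_equivalent_intertwined[d [f [g uv]]]].
  exact: intertwined_along (fun u' v' x => @intertwined_isotropic d f g u' v' x) uv.
have opG u s : spineD v u -> spineD v (walk v s) ->
    all_along (@isotropic K X h) v s -> spineD v (walk u s).
  move=> Gu /spineDP[_ sv] vs; have us := along _ _ Gu vs.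
  move/spineDP: Gu => [uS uD]; apply/spineDP; split.
    by apply: spine_trans uS _; exists s.
  have [d [f [g uv]]] := D_equivalent_intertwined uD.
  apply: D_equivalent_trans sv.
  exact: intertwined_D (intertwined_walk s uv).
have Gv : spineD v v.
  by apply/spineDP; split; [apply: spine_refl | apply: D_equivalent_refl].
split=> //.
- move=> x y Gx Gy; have [ys [vs yE]] := Gy.2.
  by rewrite -yE in Gy *; rewrite opE //; apply: opG.
- move=> x y z Gx Gy Gz; have [ys [vs yE]] := Gy.2; have [zs [vz zE]] := Gz.2.
  subst y z; rewrite (opE _ zs) // (opE x ys) // -walk_cat (opE x) //; last first.
    rewrite all_along_cat; split=> //.
    exact: along.
  by rewrite (opE _ zs) ?walk_cat //; apply: opG.
- move=> x Gx; split; last exact: (opE x [::]).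
  by have [xs [vs xE]] := Gx.2; rewrite -xE opE.
move=> x Gx; have [s [xs sE]] : spine x v by apply: spine_sym; case: Gx.
have [xS xD] := (@spineDP v x).1 Gx.
have vs : all_along (@isotropic K X h) v s.
  have [d [f [g vx]]] := D_equivalent_intertwined (D_equivalent_sym xD).
  exact: intertwined_along (fun u' v' x => @intertwined_isotropic d f g u' v' x) vx xs.
have Gy : spineD v (walk v s).
  apply/spineDP; split; first by exists s.
  have [d [f [g vx]]] := D_equivalent_intertwined (D_equivalent_sym xD).
  by have := intertwined_D (intertwined_walk s vx); rewrite sE.
have xy : sk_op v x (walk v s) = v by rewrite opE.
exists (walk v s); split=> //.
have [t [vt tE]] := Gx.2.
(* [s ++ t] is a loop at [x], since [s] leads from [x] to [v] and [t] from [v] to [x]; by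
   D-equivalence it is a loop at [v] too. *)
rewrite -[x in sk_op _ _ x]tE opE // -walk_cat.
have [d [f [g xv]]] := D_equivalent_intertwined (D_equivalent_sym xD).
apply: (@intertwined_walk_eq d f g x v (s ++ t) [::]) => //.
by rewrite walk_cat sE.
Qed.

End Walks.

(** * Root data whose Cartan matrix is a Gram matrix *)

Lemma symmetric_formC (K : fieldType) (V : vectType K) (form : {symmetric V}) u v :
  form u v = form v u.
Proof. by rewrite hermC expr0 mul1r. Qed.

Section Gram.
Variables (K : fieldType) (X : finType) (h : vectType K).
Variable form : {symmetric (dual K h)}.
Implicit Types (u v : root_datum X h) (x y : X).

Lemma gram_coef v x y : gram_cartan form v -> cartan v x x = 0 ->
  coef_a v x y = coef_b v x y.
Proof.
move=> vg x0; rewrite /coef_a /coef_b x0 eqxx /=.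
case: eqP => // _; case: ifP => // /negbT xy; rewrite [cartan v y x]vg.
by rewrite symmetric_formC -vg divff.
Qed.

Lemma gram_reflexion v x : gram_cartan form v -> cartan v x x = 0 ->
  gram_cartan form (reflexion x v).
Proof.
move=> vg x0 y z; rewrite cartan_reflexion gram_coef // !reflexion_bE.
rewrite linearDr /= !linearDl /= !linearZr_LR /= !linearZl_LR /= -!vg.
ring.
Qed.

(* Along the spine of a symmetric datum, [rd_a] is a fixed linear function of [rd_b]. *)
Lemma gram_spine_inj v u u' : gram_cartan form v -> spine v u -> spine v u' ->
  rd_b u =1 rd_b u' -> rd_p u =1 rd_p u' -> u = u'.
Proof.
move=> vg; have [phi phiE] := linear_extension (rd_a v) (rd_b_free v).
have sp w : spine v w -> gram_cartan form w /\ forall x, rd_a w x = phi (rd_b w x).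
  move: w; apply: spine_ind => [|w x _ [wg wa] [_ x0]]; first by split.
  split=> [|y]; first exact: gram_reflexion.
  by rewrite reflexion_aE reflexion_bE gram_coef // !wa linearD linearZ.
move=> /sp[_ ua] /sp[_ ua'] ub up; apply: root_datum_ext => // x.
by rewrite ua ua' ub.
Qed.

Lemma gram_spine v u : gram_cartan form v -> spine v u -> gram_cartan form u.
Proof.
move=> vg; move: u; apply: spine_ind => // w x _ wg [_ x0].
exact: gram_reflexion.
Qed.

End Gram.

(* Whether y is the long one of the two simple roots of a C_2 subsystem. *)
Definition long_over (K : fieldType) (X : finType) (h : vectType K)
    (v : root_datum X h) (y z : X) : bool :=
  2 * cartan v y z + cartan v y y == 0.

(** The condition is linear in row [y], which a D-equivalence multiplies by a nonzero scalar. *)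
Lemma long_over_D (K : fieldType) (X : finType) (h : vectType K)
    (u v : root_datum X h) y z : D_equivalent u v -> long_over u y z = long_over v y z.
Proof.
move=> [_ [d [d0 cE]]]; rewrite /long_over !cE mulrCA -mulrDr mulf_eq0.
by rewrite (negPf (d0 y)).
Qed.

(** * Integer tables of the pairings along a sequence with an inserted vector *)

Section GramTable.
Variables s n : nat.
Hypothesis n_gt0 : (0 < n)%N.

(* Gram matrix of [delta - delta_1, delta_1, .., delta_n, - delta_n]. *)
Definition gramZ (i j : nat) : int :=
  ((j == i.+1) && ((i == 0%N) || (i == n)))%:Z
  + ((i == j.+1) && ((j == 0%N) || (j == n)))%:Z - (i == j)%:Z.

(* Gram matrix of the same sequence with a unit vector orthogonal to it inserted at place [p]. *)
Definition insertZ p i j : int :=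
  if (i == p) || (j == p) then ((i == p) && (j == p))%:Z
  else gramZ (if (i < p)%N then i else i.-1) (if (j < p)%N then j else j.-1).

(** The pairings of the consecutive differences, that is, of the simple roots. *)
Definition chainZ p i j : int :=
  insertZ p i j - insertZ p i.+1 j - insertZ p i j.+1 + insertZ p i.+1 j.+1.

Lemma gramZ_id i : gramZ i i = -1.
Proof. by rewrite /gramZ; lia. Qed.

Lemma gramZC i j : gramZ i j = gramZ j i.
Proof. by rewrite /gramZ [X in X - _]addrC (eq_sym i j). Qed.

Lemma gramZ_n : gramZ n n.+1 = 1.
Proof. by rewrite /gramZ; lia. Qed.

Lemma gramZ_0 i : gramZ i i.+1 = ((i == 0%N) || (i == n))%:Z.
Proof. by rewrite /gramZ; lia. Qed.

Lemma gramZ_far i j : (i.+1 < j)%N -> gramZ i j = 0.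
Proof. by rewrite /gramZ; lia. Qed.

Lemma insertZ_id p : insertZ p p p = 1.
Proof. by rewrite /insertZ eqxx. Qed.

Lemma insertZ_ltp p i : (i < p)%N -> insertZ p i p = 0.
Proof. by move=> ip; rewrite /insertZ ltn_eqF ?eqxx. Qed.

Lemma insertZ_gtp p i : (p < i)%N -> insertZ p i p = 0.
Proof. by move=> ip; rewrite /insertZ gtn_eqF ?eqxx. Qed.

Lemma insertZC p i j : insertZ p i j = insertZ p j i.
Proof. by rewrite /insertZ orbC andbC gramZC. Qed.

Lemma insertZ_gt p i j : (p <= i)%N -> (p <= j)%N -> insertZ p i.+1 j.+1 = gramZ i j.
Proof. by move=> pi pj; rewrite /insertZ !gtn_eqF ?ltnS //= ltnNge leqW //= ltnNge leqW. Qed.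

Lemma insertZ_lt p i j : (i < p)%N -> (j < p)%N -> insertZ p i j = gramZ i j.
Proof. by move=> ip jp; rewrite /insertZ !ltn_eqF //= ip jp. Qed.

Lemma insertZ_ltgt p i j : (i < p)%N -> (p <= j)%N -> insertZ p i j.+1 = gramZ i j.
Proof. by move=> ip jp; rewrite /insertZ ltn_eqF // gtn_eqF ?ltnS //= ip ltnNge leqW. Qed.

(** The summands at [j = 0] and [j = n.+2] come from the two consecutive pairs of the sequence that
    are not orthogonal. *)
Lemma insertZ_sub_below p j : (j <= n.+2)%N -> (0 < p)%N -> (p <= n)%N ->
  insertZ p.+1 p j - insertZ p.+1 p.+1 j =
  ((j == 0%N) && (p == 1%N))%:Z + ((j == n.+2) && (p == n))%:Z - ((j == p) || (j == p.+1))%:Z.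
Proof.
move=> jn p0 pn; rewrite [insertZ _ p.+1 _]insertZC; case: (ltngtP j p.+1) => [jp|jp|->].
- rewrite insertZ_lt // insertZ_ltp // /gramZ; lia.
- case: j jp jn => // j jp jn; rewrite insertZ_ltgt // insertZ_gtp // /gramZ; lia.
- rewrite insertZ_id insertZ_ltp //; lia.
Qed.

Lemma insertZ_sub_above p j : (j <= n.+2)%N -> (0 < p)%N -> (p <= n)%N ->
  insertZ p p j - insertZ p p.+1 j =
  ((j == p) || (j == p.+1))%:Z - ((j == 0%N) && (p == 1%N))%:Z - ((j == n.+2) && (p == n))%:Z.
Proof.
move=> jn p0 pn; rewrite [insertZ _ p _]insertZC; case: (ltngtP j p) => [jp|jp|->].
- rewrite insertZ_ltp // insertZC insertZ_ltgt // /gramZ; lia.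
- case: j jp jn => // j jp jn; rewrite insertZ_gt // insertZ_gtp // /gramZ; lia.
- rewrite insertZ_id insertZ_gtp //; lia.
Qed.

Lemma chainZ_diag p i : (i == p) || (i.+1 == p) -> chainZ p i i = 0.
Proof.
case/orP => /eqP <-; rewrite /chainZ.
  by rewrite (insertZC _ i i.+1) insertZ_id insertZ_gtp // insertZ_gt ?gramZ_id.
by rewrite (insertZC _ i.+1 i) insertZ_id insertZ_ltp // insertZ_lt ?gramZ_id.
Qed.

(** The last hypothesis says that exchanging the terms [m] and [m.+1] keeps the inserted vector
    between places 1 and n + 1. At an end place, the outer isotropic root may also pair with a root
    two places away. *)
Lemma chainZ_adj p m j : (1 <= p <= n.+1)%N -> (s <= m <= n.+1)%N ->
  (s <= j <= n.+1)%N -> (m.+1 == p) && (0 < m)%N || (m == p) && (m <= n)%N ->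
  (chainZ p m j == 0) = ~~ ((j == m.+1) || (m == j.+1)).
Proof.
move=> pn mn jn /orP[]/andP[/eqP ? ?]; subst; rewrite /chainZ.
  by have := @insertZ_sub_below m j; have := @insertZ_sub_below m j.+1; lia.
by have := @insertZ_sub_above p j; have := @insertZ_sub_above p j.+1; lia.
Qed.

(** For [p <= n] the last difference is twice delta_n, of square -4 and pairing to 2 with its
    neighbour; for [p = n.+1] the last two differences are both isotropic. *)
Lemma chainZ_long_right p : (1 <= p <= n.+1)%N ->
  ((2 * chainZ p n.+1 n + chainZ p n.+1 n.+1 == 0) = (p <= n)%N) *
  ((2 * chainZ p n n.+1 + chainZ p n n == 0) = false).
Proof.
move=> /andP[p0 pn]; rewrite /chainZ !(insertZC _ n.+1 n) !(insertZC _ n.+2 n).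
rewrite !(insertZC _ n.+2 n.+1).
have [pE|[pE|pE]] : p = n.+1 \/ p = n \/ (p < n)%N by lia.
- rewrite pE insertZ_id insertZ_ltp // insertZ_ltgt // [insertZ _ n.+1 _]insertZC.
  rewrite insertZ_gtp // insertZ_gt // insertZ_lt // gramZ_n !gramZ_id; split; lia.
- rewrite pE insertZ_id ![insertZ _ n _]insertZC !insertZ_gtp // !insertZ_gt //.
  by rewrite !gramZ_id gramZ_n; split; lia.
have gt i j : (p < i)%N -> (p < j)%N -> insertZ p i j = gramZ i.-1 j.-1.
  by case: i j => [|i] [|j] //; rewrite !ltnS; apply: insertZ_gt.
rewrite !gt ?leqW //= !gramZ_id gramZ_n (_ : gramZ n.-1 n = 0); last first.
  by rewrite /gramZ; lia.
by rewrite gramZ_far; [split; lia | lia].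
Qed.

Lemma chainZ_long_left p : (1 < n)%N -> (1 <= p <= n.+1)%N ->
  ((2 * chainZ p 0 1 + chainZ p 0 0 == 0) = (1 < p)%N) *
  ((2 * chainZ p 1 0 + chainZ p 1 1 == 0) = false).
Proof.
move=> n1 /andP[p0 pn]; rewrite /chainZ !(insertZC _ 1 0) !(insertZC _ 2 0) !(insertZC _ 2 1).
have [pE|[pE|pE]] : p = 1%N \/ p = 2%N \/ (2 < p)%N by lia.
- rewrite pE insertZ_id ![insertZ _ 1 _]insertZC insertZ_ltp // insertZ_gtp // insertZ_lt //
    insertZ_ltgt // insertZ_gt // !gramZ_id /gramZ; split; lia.
- rewrite pE insertZ_id !insertZ_ltp // !insertZ_lt // !gramZ_id gramZ_0; split; lia.
have p1 : (1 < p)%N by lia.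
rewrite !insertZ_lt // !gramZ_id !gramZ_0 gramZ_far //; split; lia.
Qed.

End GramTable.

Lemma long_intr (K : numFieldType) (u w : int) :
  (2 * u%:~R + w%:~R == 0 :> K) = (2 * u + w == 0).
Proof. by rewrite -[RHS](intr_eq0 K) intrD intrM. Qed.

(** With [b] the orientation of an end and [c] the presence of a long root there, the two
    conjunctions are the two values of [long_over] at that end. *)
Lemma andb_compl_inj (b b' c c' : bool) : ~~ b && c = ~~ b' && c' ->
  b && c = b' && c' -> c = c' /\ (c -> b = b').
Proof. by case: b; case: b'; case: c; case: c'. Qed.

(** * Root data described by a sequence, and the motions of the inserted vector *)

Section Chain.
Variables (K : numFieldType) (h : vectType K) (form : {symmetric (dual K h)}).
Variables (X : finType) (s n : nat) (dx : nat -> dual K h).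
Hypothesis n_gt0 : (0 < n)%N.
Hypothesis s_le1 : (s <= 1)%N.

Hypothesis form_dx : forall i j, (s <= i <= n.+1)%N -> (s <= j <= n.+1)%N ->
  form (dx i) (dx j) = (gramZ n i j)%:~R.

Implicit Types (c : nat -> X) (e : dual K h) (p : nat) (v u : root_datum X h).

(* In the finite type [s = 1] and [dx 0] is irrelevant; in the affine type [s = 0]. *)
Definition labelling c : Prop :=
  (forall x, exists2 j, (s <= j <= n.+1)%N & x = c j) /\
  {in [pred j | s <= j <= n.+1]%N &, injective c}.

Definition unit_orthogonal e : Prop :=
  form e e = 1 /\ forall j, (s <= j <= n.+1)%N -> form e (dx j) = 0.

Definition insert e p j : dual K h :=
  if (j < p)%N then dx j else if j == p then e else dx j.-1.

(* The parities say that exactly the simple roots involving [e] are odd. *)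
Definition chain c e p v : Prop :=
  [/\ forall j, (s <= j <= n.+1)%N -> rd_b v (c j) = insert e p j - insert e p j.+1,
      forall j, (s <= j <= n.+1)%N -> rd_p v (c j) = ((j == p) || (j.+1 == p))%:R
    & gram_cartan form v].

Lemma form_insert e p i j : unit_orthogonal e -> (1 <= p <= n.+1)%N ->
  (s <= i <= n.+2)%N -> (s <= j <= n.+2)%N ->
  form (insert e p i) (insert e p j) = (insertZ n p i j)%:~R.
Proof.
move=> [e1 e0] pn ip jp; rewrite /insert /insertZ.
case: (ltngtP i p) => ip'; case: (ltngtP j p) => jp' //=;
  rewrite ?e1 ?form_dx ?e0 1?symmetric_formC ?e0 //; lia.
Qed.

Lemma cartan_chain c e p v i j : unit_orthogonal e -> (1 <= p <= n.+1)%N ->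
  (s <= i <= n.+1)%N -> (s <= j <= n.+1)%N -> chain c e p v ->
  cartan v (c i) (c j) = (chainZ n p i j)%:~R.
Proof.
move=> e1 pn ip jp [vb _ vg]; rewrite vg !vb // linearBl /= !linearBr /=.
rewrite !form_insert //; [|lia..].
rewrite /chainZ !(rmorphD, rmorphB) /=; ring.
Qed.

Lemma insert_lt e p j : (j < p)%N -> insert e p j = dx j.
Proof. by rewrite /insert => ->. Qed.

Lemma insert_id e p : insert e p p = e.
Proof. by rewrite /insert ltnn eqxx. Qed.

Lemma insert_gt e p j : (p <= j)%N -> insert e p j.+1 = dx j.
Proof. by move=> pj; rewrite /insert ltnNge leqW //= gtn_eqF. Qed.

Lemma insert_swap e p p' m j :
  ((m.+1 == p) && (p' == m) || (m == p) && (p' == m.+1))%N ->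
  insert e p' j = insert e p (if j == m then m.+1 else if j == m.+1 then m else j).
Proof.
move=> mp; rewrite /insert; case: (eqVneq j m) => [->|jm].
  by case/orP: mp => /andP[/eqP <- /eqP ->]; repeat (case: ifP => ?);
    first [done | congr (dx _); lia | exfalso; lia].
case: (eqVneq j m.+1) => [->|jm1];
  case/orP: mp => /andP[/eqP <- /eqP ->]; repeat (case: ifP => ?);
    first [done | congr (dx _); lia | exfalso; lia].
Qed.

Lemma labelling_ind c (P : X -> Prop) : labelling c ->
  (forall j, (s <= j <= n.+1)%N -> P (c j)) -> forall x, P x.
Proof. by move=> [cs _] Pc x; have [j jn ->] := cs x; apply: Pc. Qed.

Lemma labelling_eq c i j : labelling c -> (s <= i <= n.+1)%N ->
  (s <= j <= n.+1)%N -> (c i == c j) = (i == j).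
Proof. by move=> [_ ci] ip jp; apply/eqP/eqP => [/ci|->//]; apply; rewrite inE. Qed.

Lemma chain_isotropic c e p v m : unit_orthogonal e -> (1 <= p <= n.+1)%N ->
  (s <= m <= n.+1)%N -> chain c e p v ->
  isotropic v (c m) <-> (m == p) || (m.+1 == p).
Proof.
move=> e1 pn mn vc; rewrite isotropicE.
have [_ vp _] := vc; rewrite vp //; split=> [[_]|mp]; first by case: (_ || _).
by rewrite (cartan_chain e1 pn mn mn vc) chainZ_diag // mp.
Qed.

(** By [chainZ_adj] the reflexion negates the root of place [m] and adds it to its two neighbours
    only, which is the effect of exchanging the terms [m] and [m.+1]; the same neighbours change
    parity. *)
Lemma chain_reflexion c e p p' m v : labelling c -> unit_orthogonal e ->
  (1 <= p <= n.+1)%N -> (1 <= p' <= n.+1)%N -> (s <= m <= n.+1)%N ->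
  (m.+1 == p) && (p' == m) || (m == p) && (p' == m.+1) ->
  chain c e p v -> chain c e p' (reflexion (c m) v).
Proof.
move=> cl e1 pn pn' mn mp vc.
have [vb vp vg] := vc.
have m0 : cartan v (c m) (c m) = 0.
  by rewrite (cartan_chain e1 pn mn mn vc) chainZ_diag //; lia.
have adj j : (s <= j <= n.+1)%N ->
    (cartan v (c m) (c j) == 0) = ~~ ((j == m.+1) || (m == j.+1)).
  move=> jn; rewrite (cartan_chain e1 pn mn jn vc) intr_eq0.
  by apply: chainZ_adj pn mn jn _ => //; lia.
split; last exact: gram_reflexion.
- move=> j jn; rewrite !(insert_swap _ _ mp) /= ffunE m0 eqxx /= labelling_eq // adj // !vb //.
  case: (eqVneq j m) => [->|jm].
    by rewrite eqxx gtn_eqF // opprB.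
  rewrite eqSS (negPf jm).
  case: (eqVneq j m.+1) => [->|jm1] /=.
    by rewrite gtn_eqF // addrC addrA subrK.
  by rewrite (eq_sym m); case: eqP => [->|_] //=; rewrite addrA subrK.
- move=> j jn; rewrite /= ffunE m0 eqxx /= labelling_eq // adj // !vp //.
  case: (eqVneq j m) => [->|jm].
    by congr (nat_of_bool _)%:R; lia.
  have two : 1 + 1 = 0 :> 'Z_2 by apply: val_inj.
  case: ifP => jm1; first by congr (nat_of_bool _)%:R; lia.
  case: (boolP (_ || _)) => jp; rewrite ?two ?add0r;
    [symmetry; rewrite (_ : _ || _ = false) // | rewrite (_ : _ || _ = true) //]; lia.
Qed.

Definition swap_ends (a b : bool) (j : nat) : nat :=
  if a && (j <= 1)%N then (1 - j)%N
  else if b && (n <= j <= n.+1)%N then (n + n.+1 - j)%N else j.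

(** The left exchange occurs only in the affine type; [1 < n] keeps the exchanged pairs 0, 1 and n,
    n + 1 disjoint. *)
Definition left_end (a : bool) : Prop := a -> s = 0%N /\ (1 < n)%N.

Lemma swap_endsP a b (j : nat) :
  (a && (j <= 1) && (swap_ends a b j == 1 - j)
  || [&& ~~ (a && (j <= 1)), b, n <= j <= n.+1 & swap_ends a b j == n + n.+1 - j]
  || [&& ~~ (a && (j <= 1)), ~~ (b && (n <= j <= n.+1)) & swap_ends a b j == j])%N.
Proof.
rewrite /swap_ends; case: (a && _) => /=; first by rewrite eqxx.
by case: b => /=; case: (n <= j <= n.+1)%N => /=; rewrite eqxx.
Qed.

Lemma labelling_swap x a b : labelling x -> left_end a -> labelling (x \o swap_ends a b).
Proof.
move=> [xs xi] la; have sw j : (s <= j <= n.+1)%N ->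
    (s <= swap_ends a b j <= n.+1)%N /\ swap_ends a b (swap_ends a b j) = j.
  move=> jn; have := swap_endsP a b j; have := swap_endsP a b (swap_ends a b j).
  by case: a la => [/(_ isT)[s0 n1]|_]; lia.
split=> [y|i j]; first by have [j /sw[jn <-] ->] := xs y; exists (swap_ends a b j).
rewrite !inE => /sw[si si'] /sw[sj sj'] /= /xi; rewrite !inE si sj => /(_ isT isT) ij.
by rewrite -si' ij.
Qed.

(** The last two roots are [dx n - e] and [e + dx n], both odd; changing the sign of [e] exchanges
    them. *)
Lemma chain_flip_right x a b e v : dx n.+1 = - dx n -> left_end a ->
  chain (x \o swap_ends a b) e n.+1 v ->
  chain (x \o swap_ends a (~~ b)) (- e) n.+1 v.
Proof.
move=> dxn la [vb vp vg].
have sw j : (s <= j <= n.+1)%N -> exists j', [/\ swap_ends a (~~ b) j = swap_ends a b j',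
    (s <= j' <= n.+1)%N &
    [\/ j = n /\ j' = n.+1, j = n.+1 /\ j' = n | (j < n)%N /\ j' = j]].
  move=> jn; have [jn'|jn'] := ltnP j n.
    exists j; split=> //; last by apply: Or33.
    by rewrite /swap_ends [(n <= j)%N]leqNgt jn' /= !andbF.
  exists (n + n.+1 - j)%N; split; last 1 first.
  - have [->|?] := eqVneq j n; first by apply: Or31; split=> //; lia.
    by apply: Or32; split; lia.
  - have := swap_endsP a b (n + n.+1 - j); have := swap_endsP a (~~ b) j.
    by case: a la {vb vp} => [/(_ isT)[s0 n1]|_]; lia.
  - lia.
split=> // j /sw[j' [/= -> jn' jj]].
- rewrite vb //; case: jj => [[-> ->]|[-> ->]|[jn ->]].
  + by rewrite !insert_id insert_gt // insert_lt // dxn !opprK addrC.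
  + by rewrite !insert_id insert_gt // insert_lt // dxn opprK addrC.
  + by rewrite !insert_lt // ltnS ltnW.
- by rewrite vp //; congr (nat_of_bool _)%:R; case: jj => [[-> ->]|[-> ->]|[jn ->]]; lia.
Qed.

(** The first two roots are [d - dx 1 - e] and [e - dx 1], both odd; replacing [e] by [d - e]
    exchanges them. *)
Lemma chain_flip_left x a b e d v : dx 0 = d - dx 1 -> s = 0%N -> (1 < n)%N ->
  chain (x \o swap_ends a b) e 1 v ->
  chain (x \o swap_ends (~~ a) b) (d - e) 1 v.
Proof.
move=> dx0 s0 n1 [vb vp vg].
have sw j : exists j', swap_ends (~~ a) b j = swap_ends a b j' /\
    [\/ j = 0%N /\ j' = 1%N, j = 1%N /\ j' = 0%N | (1 < j)%N /\ j' = j].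
  have [->|[->|j1]] : j = 0%N \/ j = 1%N \/ (1 < j)%N by lia.
  - exists 1%N; split; last by apply: Or31.
    by rewrite /swap_ends; case: a {vb vp}; case: b => //=; rewrite ifF //; lia.
  - exists 0%N; split; last by apply: Or32.
    by rewrite /swap_ends; case: a {vb vp}; case: b => //=; rewrite ifF //; lia.
  - exists j; split; last by apply: Or33.
    by rewrite /swap_ends leqNgt j1 !andbF.
split=> // j; have [j' [/= -> jj]] := sw j => jn.
- rewrite vb; last by case: jj; lia.
  case: jj => [[-> ->]|[-> ->]|[j1 ->]].
  + by rewrite !insert_id insert_gt // insert_lt // dx0 opprB [RHS]addrC addrA subrK.
  + by rewrite !insert_id insert_gt // insert_lt // dx0 addrAC.
  + by case: j j1 {jn} => // j j1; rewrite !insert_gt // ltnW.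
- rewrite vp; last by case: jj; lia.
  by congr (nat_of_bool _)%:R; case: jj; lia.
Qed.

(** Roots are differences of terms, so [g] carries one description to the other. The identity yields
    uniqueness of the vertex described, and translations yield the generator of the affine group. *)
Lemma chain_map (g : dual K h -> dual K h) c e e' p u v : labelling c ->
  {morph g : x y / x - y} -> (forall j, (s <= j <= n.+1)%N -> g (dx j) = dx j) ->
  g e = e' -> (1 <= p <= n.+1)%N -> chain c e p u ->
  chain c e' p v <-> (forall x, rd_b v x = g (rd_b u x)) /\ rd_p v = rd_p u /\
                   gram_cartan form v.
Proof.
move=> cl gB gdx <- pn [ub up ug].
have gi j : (s <= j <= n.+2)%N -> g (insert e p j) = insert (g e) p j.
  by move=> jn; rewrite /insert; repeat (case: ifP => ?) => //; apply: gdx; lia.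
split=> [[vb vp vg]|[vb [vp vg]]].
  split.
    apply: (labelling_ind cl) => j jn; rewrite vb // ub // gB !gi //; lia.
  split=> //; apply/ffunP; apply: (labelling_ind cl) => j jn.
  by rewrite vp // up.
split=> // j jn; last by rewrite vp up.
rewrite vb ub // gB !gi //; lia.
Qed.

Lemma chain_long_right x a b e p v : labelling x -> left_end a ->
  unit_orthogonal e -> (1 <= p <= n.+1)%N -> chain (x \o swap_ends a b) e p v ->
  long_over v (x n.+1) (x n) = ~~ b && (p <= n)%N /\
  long_over v (x n) (x n.+1) = b && (p <= n)%N.
Proof.
move=> xl la e1 pn vc.
have n1 : (s <= n <= n.+1)%N by lia.
have n2 : (s <= n.+1 <= n.+1)%N by lia.
have [H1 H2] := chainZ_long_right n_gt0 pn.
have swn : swap_ends a b n = if b then n.+1 else n.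
  have := swap_endsP a b n.
  by case: a la {vc} => [/(_ isT)[s0 n3]|_]; case: b => /=; lia.
have swn1 : swap_ends a b n.+1 = if b then n else n.+1.
  have := swap_endsP a b n.+1.
  by case: a la {vc swn} => [/(_ isT)[s0 n3]|_]; case: b => /=; lia.
have := cartan_chain e1 pn n1 n2 vc; have := cartan_chain e1 pn n2 n1 vc.
have := cartan_chain e1 pn n1 n1 vc; have := cartan_chain e1 pn n2 n2 vc.
rewrite /long_over /= swn swn1 => c22 c11 c21 c12.
have L1 : 2 * (chainZ n p n.+1 n)%:~R + (chainZ n p n.+1 n.+1)%:~R == 0 :> K = (p <= n)%N.
  by rewrite long_intr H1.
have L2 : 2 * (chainZ n p n n.+1)%:~R + (chainZ n p n n)%:~R == 0 :> K = false.
  by rewrite long_intr H2.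
by move: c22 c11 c21 c12; case: b {vc swn swn1} => -> -> -> ->; rewrite L1 L2.
Qed.

Lemma chain_long_left x a b e p v : labelling x -> s = 0%N -> (1 < n)%N ->
  unit_orthogonal e -> (1 <= p <= n.+1)%N -> chain (x \o swap_ends a b) e p v ->
  long_over v (x 0) (x 1) = ~~ a && (1 < p)%N /\
  long_over v (x 1) (x 0) = a && (1 < p)%N.
Proof.
move=> xl s0 n1 e1 pn vc.
have n2 : (s <= 0 <= n.+1)%N by lia.
have n3 : (s <= 1 <= n.+1)%N by lia.
have [H1 H2] := chainZ_long_left n_gt0 n1 pn.
have sw0 : swap_ends a b 0 = if a then 1%N else 0%N.
  by rewrite /swap_ends; case: a {vc}; case: b => //=; rewrite ifF //; lia.
have sw1 : swap_ends a b 1 = if a then 0%N else 1%N.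
  by rewrite /swap_ends; case: a {vc sw0}; case: b => //=; rewrite ifF //; lia.
have := cartan_chain e1 pn n2 n3 vc; have := cartan_chain e1 pn n3 n2 vc.
have := cartan_chain e1 pn n2 n2 vc; have := cartan_chain e1 pn n3 n3 vc.
rewrite /long_over /= sw0 sw1 => c22 c11 c21 c12.
have L1 : 2 * (chainZ n p 0 1)%:~R + (chainZ n p 0 0)%:~R == 0 :> K = (1 < p)%N.
  by rewrite long_intr H1.
have L2 : 2 * (chainZ n p 1 0)%:~R + (chainZ n p 1 1)%:~R == 0 :> K = false.
  by rewrite long_intr H2.
by move: c22 c11 c21 c12; case: a {vc sw0 sw1} => -> -> -> ->; rewrite L1 L2.
Qed.

(** D-equivalence respects the long roots. A long root at an end reveals the label exchange there,
    and its absence puts the inserted vector at that end; when both exchanges are known, the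
    parities give the place. *)
Lemma chain_D x a b e p u a' b' e' p' v : labelling x -> left_end a -> left_end a' ->
  (s = 0%N -> (1 < n)%N) ->
  unit_orthogonal e -> (1 <= p <= n.+1)%N -> chain (x \o swap_ends a b) e p u ->
  unit_orthogonal e' -> (1 <= p' <= n.+1)%N -> chain (x \o swap_ends a' b') e' p' v ->
  D_equivalent u v ->
  [/\ p = p', p = n.+1 \/ b = b' & p = 1%N /\ s = 0%N \/ a = a'].
Proof.
move=> xl la la' n1 e1 pn uc e1' pn' vc uv.
have [r1 r2] := chain_long_right xl la e1 pn uc.
have [] := chain_long_right xl la' e1' pn' vc.
rewrite -!(long_over_D _ _ uv) {}r1 {}r2 => r1 r2.
have [{r1 r2}pn1 bb] := andb_compl_inj r1 r2.
have l : s = 0%N -> ((1 < p) = (1 < p'))%N /\ ((1 < p)%N -> a = a').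
  move=> s0; have [l1 l2] := chain_long_left xl s0 (n1 s0) e1 pn uc.
  have [] := chain_long_left xl s0 (n1 s0) e1' pn' vc.
  by rewrite -!(long_over_D _ _ uv) l1 l2; apply: andb_compl_inj.
have bE : p = n.+1 \/ b = b'.
  have [->|pn2] : p = n.+1 \/ (p <= n)%N by lia.
    by left.
  by right; apply: bb.
have aE : p = 1%N /\ s = 0%N \/ a = a'.
  have [s0|s0] := eqVneq s 0%N; last first.
    have F (c : bool) : left_end c -> c = false.
      by case: c => // /(_ isT)[sE]; rewrite sE eqxx in s0.
    by right; rewrite (F _ la) (F _ la').
  have [p1 aa] := l s0; have [->|p2] : p = 1%N \/ (1 < p)%N by lia.
    by left.
  by right; apply: aa.
split=> //; case: bE => [pE|bE]; first by lia.
case: aE => [[p1 s0]|aE]; first by have [] := l s0; lia.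
subst a' b'; case: uc => _ up _; case: vc => _ vp _; case: uv => pE _.
(* The odd labels are those of places [p - 1] and [p], and likewise for [p']; testing at [p] gives
   [p <= p'], testing at [p'] the converse. *)
have par j : (s <= j <= n.+1)%N -> (j == p) || (j.+1 == p) = (j == p') || (j.+1 == p').
  by move=> jn; have := up _ jn; rewrite pE vp //; case: (_ || _); case: (_ || _).
have := par p; have := par p'; rewrite !eqxx /=; lia.
Qed.

Lemma chain_down c e p v : labelling c -> unit_orthogonal e ->
  (s < p <= n.+1)%N -> (1 < p)%N -> chain c e p v ->
  isotropic v (c p.-1) /\ chain c e p.-1 (reflexion (c p.-1) v).
Proof.
move=> cl e1 pn p1 vc; split.
  by apply/(chain_isotropic e1 _ _ vc); lia.
by apply: (chain_reflexion cl e1 _ _ _ _ vc); lia.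
Qed.

Lemma chain_up c e p v : labelling c -> unit_orthogonal e ->
  (1 <= p <= n)%N -> chain c e p v ->
  isotropic v (c p) /\ chain c e p.+1 (reflexion (c p) v).
Proof.
move=> cl e1 pn vc; split.
  by apply/(chain_isotropic e1 _ _ vc); lia.
by apply: (chain_reflexion cl e1 _ _ _ _ vc); lia.
Qed.

(** At an end place, the isotropic root on the outer side becomes the inner one in the flipped
    description of the same vertex, so its reflexion is again a move away from the end. *)
Lemma chain_step x a b e d p v y : labelling x -> left_end a ->
  (s = 0%N -> (1 < n)%N) -> dx n.+1 = - dx n -> (s = 0%N -> dx 0 = d - dx 1) ->
  unit_orthogonal e -> unit_orthogonal (- e) -> (s = 0%N -> unit_orthogonal (d - e)) ->
  (1 <= p <= n.+1)%N -> chain (x \o swap_ends a b) e p v -> isotropic v y ->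
  [\/ (1 < p)%N /\ chain (x \o swap_ends a b) e p.-1 (reflexion y v),
      (p <= n)%N /\ chain (x \o swap_ends a b) e p.+1 (reflexion y v),
      p = n.+1 /\ chain (x \o swap_ends a (~~ b)) (- e) n (reflexion y v)
    | [/\ p = 1%N, s = 0%N &
        chain (x \o swap_ends (~~ a) b) (d - e) 2 (reflexion y v)]].
Proof.
move=> xl la n1 dxn dx0 e1 e1' e1'' pn vc.
have cl := labelling_swap b xl la.
have [m mn ->] := cl.1 y.
move/(chain_isotropic e1 pn mn vc) => mp.
have [mE|[mE|[[mE pE]|[mE pE]]]] : (m.+1 = p /\ 0 < m)%N \/ (m = p /\ p <= n)%N \/
  (m = n.+1 /\ p = n.+1) \/ (m = 0%N /\ p = 1%N) by lia.
- have [<- p1] := mE; apply: Or41; split=> //.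
  have [||_] := chain_down cl e1 _ _ vc; rewrite -?mE.1 //; lia.
- by have [-> p1] := mE; apply: Or42; split=> //; have [|_] := chain_up cl e1 _ vc; first lia.
- rewrite pE in vc; apply: Or43; split=> //.
  have vc' := chain_flip_right dxn la vc.
  have -> : (x \o swap_ends a b) m = (x \o swap_ends a (~~ b)) n.
    congr x; rewrite mE; have := swap_endsP a b n.+1; have := swap_endsP a (~~ b) n.
    by clear -n_gt0 la; case: a la => [/(_ isT)[s0 n3]|_]; case: b => /=; lia.
  by have [||_ //] := chain_down (labelling_swap (~~ b) xl la) e1' _ _ vc'; lia.
- have s0 : s = 0%N by lia.
  rewrite pE in vc; apply: Or44; split=> //.
  have vc' := chain_flip_left (dx0 s0) s0 (n1 s0) vc.
  have -> : (x \o swap_ends a b) m = (x \o swap_ends (~~ a) b) 1%N.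
    congr x; rewrite mE; have := n1 s0.
    by rewrite /swap_ends; case: a {la vc vc' cl}; case: b => //= n3; rewrite ifF //; lia.
  have la' : left_end (~~ a) by move=> _; split=> //; apply: n1.
  by have [|_ //] := chain_up (labelling_swap b xl la') (e1'' s0) _ vc'; lia.
Qed.

End Chain.

(** * Pairings of delta_1, ..., delta_n, - delta_n *)

Section Ends.
Variables (K : numFieldType) (h : vectType K) (form : {symmetric (dual K h)}).
Variables (n : nat) (eps : dual K h) (dl : nat -> dual K h).
Hypothesis n_gt0 : (0 < n)%N.
Hypothesis gram_eps_dl : eps_delta_gram form n eps dl.

Definition with_ends (z : dual K h) (j : nat) : dual K h :=
  if j == 0%N then z else if j == n.+1 then - dl n else dl j.

Lemma form_dl i j : (1 <= i <= n.+1)%N -> (1 <= j <= n.+1)%N -> forall z,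
  form (with_ends z i) (with_ends z j) = (gramZ n i j)%:~R.
Proof.
have [_ gd _] := gram_eps_dl => /andP[i0 iN] /andP[j0 jN] z.
rewrite /with_ends (gtn_eqF i0) (gtn_eqF j0).
case: (eqVneq i n.+1) => [->|iE]; case: (eqVneq j n.+1) => [->|jE].
- by rewrite linearNl linearNr /= opprK gd ?n_gt0 ?leqnn // eqxx gramZ_id.
- rewrite linearNl /= gd ?n_gt0 ?leqnn ?j0 //; last by lia.
  rewrite opprK (_ : gramZ n n.+1 j = (n == j)%:Z); first by rewrite pmulrn.
  by rewrite /gramZ; lia.
- rewrite linearNr /= gd ?n_gt0 ?leqnn ?i0 //; last by lia.
  rewrite opprK (_ : gramZ n i n.+1 = (i == n)%:Z); first by rewrite pmulrn.
  by rewrite /gramZ; lia.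
rewrite gd; [|lia..]; rewrite (_ : gramZ n i j = - (i == j)%:Z).
  by rewrite rmorphN /= -pmulrn.
by rewrite /gramZ; lia.
Qed.

Lemma form_eps_dl z j : (1 <= j <= n.+1)%N -> form eps (with_ends z j) = 0.
Proof.
have [_ _ g0] := gram_eps_dl => /andP[j0 jN]; rewrite /with_ends (gtn_eqF j0).
by case: (eqVneq j n.+1) => [_|jE]; rewrite ?linearNr /= ?g0 ?oppr0 //; lia.
Qed.

Lemma unit_orthogonalN s dx e :
  unit_orthogonal form s n dx e -> unit_orthogonal form s n dx (- e).
Proof.
move=> [e1 e0]; split=> [|j jn]; first by rewrite linearNl linearNr /= opprK.
by rewrite linearNl /= e0 ?oppr0.
Qed.

End Ends.

(** * Type C(n+1) *)

Section FiniteType.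
Variables (K : numFieldType) (n : nat) (h : vectType K).
Variables (form : {symmetric (dual K h)}) (eps : dual K h) (dl : nat -> dual K h).
Variable v0 : root_datum 'I_n.+1 h.
Hypothesis n_gt0 : (0 < n)%N.
Hypothesis v0C : type_C form eps dl v0.

Let x (j : nat) : 'I_n.+1 := inord j.-1.
Let dx := with_ends n dl 0.
Let e (b : bool) : dual K h := if b then - eps else eps.

Let x_labelling : labelling 1 n x.
Proof.
split=> [y|i j].
  by exists y.+1; rewrite ?ltn_ord // /x /= inord_val.
rewrite !inE /x => ip jp /(congr1 (@nat_of_ord _)); rewrite !inordK; lia.
Qed.

Let form_dx i j : (1 <= i <= n.+1)%N -> (1 <= j <= n.+1)%N ->
  form (dx i) (dx j) = (gramZ n i j)%:~R.
Proof. by case: v0C => _ g _ _ _ ip jp; apply: form_dl g _ _ _ _ _. Qed.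

Let unit_e b : unit_orthogonal form 1 n dx (e b).
Proof.
have [_ g _ _ _] := v0C.
have u : unit_orthogonal form 1 n dx eps.
  by split=> [|j jn]; [case: g | apply: form_eps_dl g _ _ _].
by case: b => //; apply: unit_orthogonalN.
Qed.

Let dx_last : dx n.+1 = - dx n.
Proof. by rewrite /dx /with_ends eqxx (gtn_eqF n_gt0) (ltn_eqF (ltnSn n)). Qed.

Let no_left : left_end 1 n false. Proof. by []. Qed.

(** The exchange of the last two labels always goes with the change of sign of [eps], so one boolean
    records both; at [p = n.+1] its two values describe the same vertex. *)
Let state b p v := chain form 1 n dx (x \o swap_ends n false b) (e b) p v.

Lemma spine_C u : spine v0 u -> exists b p, (1 <= p <= n.+1)%N /\ state b p u.
Proof.
move: u; apply: spine_ind => [|u y _ [b [p [pn ub]]] uy].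
  (* At [v0] the vector [eps] stands between delta_n and - delta_n. *)
  exists false, n.+1; rewrite leqnn; split=> //.
  have [_ _ vb vp vg] := v0C; split=> // j /andP[j0 jn]; rewrite /= /swap_ends /= /x.
  - rewrite vb inordK; last by lia.
    rewrite prednK // /C_root.
    have [jE|[->|->]] : (j < n)%N \/ j = n \/ j = n.+1 by lia.
    + rewrite jE !insert_lt ?ltnS ?(ltnW jE) // /dx /with_ends (gtn_eqF j0) /=.
      by rewrite eqSS !ltn_eqF // ltnW.
    + rewrite ltnn eqxx insert_lt // insert_id /dx /with_ends gtn_eqF //.
      by rewrite ltn_eqF.
    + rewrite ltnNge leqnSn gtn_eqF //= insert_id insert_gt // /dx /with_ends /=.
      by rewrite eqxx opprK addrC.
  - rewrite vp inordK; last by lia.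
    rewrite prednK // /C_parity.
    by case: ifP => jE; rewrite (_ : _ || _ = ~~ (j < n)%N) ?jE //; lia.
have F (T : Prop) : 1%N = 0%N -> T by [].
have := @chain_step _ _ form _ 1 n dx n_gt0 isT form_dx x false b (e b) 0 p u y
  x_labelling no_left (F _) dx_last (F _) (unit_e b) (unit_orthogonalN (unit_e b))
  (F _) pn ub uy.
case=> [[p1 H]|[pn' H]|[pE H]|[]] //.
- by exists b, p.-1; split=> //; lia.
- by exists b, p.+1; split=> //; lia.
- exists (~~ b), n; split; first by lia.
  by move: H; rewrite /state /e; case: b {ub}; rewrite /= ?opprK.
Qed.

(** [chain_D] leaves only the value of [b] at [p = n.+1] open, where a flip reconciles the two
    descriptions; a common description gives the same roots and parities. *)
Lemma spine_C_inj u v : spine v0 u -> spine v0 v -> D_equivalent u v -> u = v.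
Proof.
move=> us vs uv; have [_ _ _ _ v0g] := v0C.
have [b [p [pn ub]]] := spine_C us; have [b' [p' [pn' vb]]] := spine_C vs.
have [pp bb _] : [/\ p = p', p = n.+1 \/ b = b' & p = 1%N /\ 1%N = 0%N \/ false = false].
  exact: (chain_D n_gt0 (s := 1) isT form_dx x_labelling no_left no_left _
    (unit_e b) pn ub (unit_e b') pn' vb uv).
subst p'; have {}ub : state b' p u.
  case: bb => [pE|<-//]; subst p; have [<-//|bb] := eqVneq b b'.
  have := chain_flip_right n_gt0 (s := 1) isT dx_last no_left ub.
  by move: bb; rewrite /state /e; case: (b); case: (b') => //=; rewrite opprK.
have [+ _] := chain_map n_gt0 (s := 1) isT v
  (labelling_swap n_gt0 (s := 1) isT b' x_labelling no_left)
  (g := id) (fun _ _ => erefl) (fun _ _ => erefl) erefl pn ub.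
move=> /(_ vb)[vE [pE _]]; apply: gram_spine_inj v0g us vs _ _ => y.
  by rewrite vE.
by rewrite pE.
Qed.

Lemma spineD_C v : spine v0 v -> trivial_group (sk_op v) v (spineD v).
Proof.
move=> vs; split; first exact: spineD_group.
apply/seteqP; split=> u.
  move=> /spineDP[uv uD]; apply: spine_C_inj => //.
  exact: spine_trans vs uv.
by move=> ->; apply/spineDP; split; [apply: spine_refl | apply: D_equivalent_refl].
Qed.

End FiniteType.

(** * Translations along an isotropic vector *)

Section Translation.
Variables (K : fieldType) (V : vectType K) (form : {symmetric V}) (eps d : V).

(** In the affine type, on vectors orthogonal to [d], the value c = 2 m gives the m-th power of
    Psi. *)
Definition translation (c : K) (nu : V) : V := nu + (c * form nu eps) *: d.

Lemma translation_linear c : linear (translation c).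
Proof.
move=> a u v; rewrite /translation linearDl /= linearZl_LR /= scalerDr scalerA.
by rewrite mulrDr mulrCA scalerDl addrACA.
Qed.

HB.instance Definition _ c :=
  GRing.isLinear.Build K V V *:%R (translation c) (translation_linear c).

Lemma form_translation c u v : form d d = 0 -> form u d = 0 -> form v d = 0 ->
  form (translation c u) (translation c v) = form u v.
Proof.
move=> dd ud vd; rewrite /translation linearDl /= !linearDr /= !linearZr_LR /=.
rewrite !linearZl_LR /= (symmetric_formC form d v) ud vd dd.
by rewrite !mulr0 !addr0.
Qed.

End Translation.

(** * Type C(n+1)^(1) *)

Section AffineType.
Variables (K : numFieldType) (n : nat) (h : vectType K).
Variables (form : {symmetric (dual K h)}) (eps : dual K h) (dl : nat -> dual K h).
Variables (d L0 : dual K h) (v0 : root_datum 'I_n.+2 h).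
Hypothesis n_gt1 : (1 < n)%N.
Hypothesis v0C : type_C1 form eps dl d L0 v0.

Let n_gt0 : (0 < n)%N := ltnW n_gt1.
Let x (j : nat) : 'I_n.+2 := inord j.
Let dx := with_ends n dl (d - dl 1).

Let x_labelling : labelling 0 n x.
Proof.
split=> [y|i j]; first by exists y; rewrite ?leq_ord // /x inord_val.
rewrite !inE /x => ip jp /(congr1 (@nat_of_ord _)); rewrite !inordK //.
Qed.

Let dx_last : dx n.+1 = - dx n.
Proof. by rewrite /dx /with_ends eqxx (gtn_eqF n_gt0) (ltn_eqF (ltnSn n)). Qed.

Let dx1 : dx 1 = dl 1.
Proof. by rewrite /dx /with_ends /= eqSS (ltn_eqF n_gt0). Qed.

Let dx0 : dx 0 = d - dx 1. Proof. by rewrite dx1. Qed.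

Let gram_eps : eps_delta_gram form n eps dl. Proof. by case: v0C => _ _ []. Qed.

Let form_d_dl j : (1 <= j <= n.+1)%N -> form d (dx j) = 0.
Proof.
have [_ _ [_ [_ _ g0]] _ _] := v0C => /andP[j0 jN].
rewrite /dx /with_ends (gtn_eqF j0).
by case: (eqVneq j n.+1) => [_|jE]; rewrite ?linearNr /= ?g0 ?oppr0 //; lia.
Qed.

Let form_dd : form d d = 0. Proof. by case: v0C => _ _ [_ []]. Qed.
Let form_deps : form d eps = 0. Proof. by case: v0C => _ _ [_ []]. Qed.
Let form_epsd : form eps d = 0. Proof. by rewrite symmetric_formC form_deps. Qed.
Let form_epseps : form eps eps = 1. Proof. by case: gram_eps. Qed.

Let form_d_dx j : (j <= n.+1)%N -> form d (dx j) = 0.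
Proof.
case: j => [_|j jn]; last exact: form_d_dl.
by rewrite dx0 linearBr /= form_dd form_d_dl // subr0.
Qed.

Let form_eps_dx j : (j <= n.+1)%N -> form eps (dx j) = 0.
Proof.
case: j => [_|j jn]; last exact: (form_eps_dl n_gt0 gram_eps).
by rewrite dx0 linearBr /= form_epsd (form_eps_dl n_gt0 gram_eps) // subr0.
Qed.

Let form_dx i j : (0 <= i <= n.+1)%N -> (0 <= j <= n.+1)%N ->
  form (dx i) (dx j) = (gramZ n i j)%:~R.
Proof.
have D a b : (1 <= a <= n.+1)%N -> (1 <= b <= n.+1)%N ->
    form (dx a) (dx b) = (gramZ n a b)%:~R.
  by move=> an bn; apply: (form_dl n_gt0 gram_eps).
have F b : (1 <= b <= n.+1)%N -> form (dx 0) (dx b) = (gramZ n 0 b)%:~R.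
  move=> bn; rewrite dx0 linearBl /= form_d_dl // sub0r D // -rmorphN /=.
  by congr (_%:~R); rewrite /gramZ; lia.
case: i j => [|i] [|j] /= iN jN; last exact: D.
- rewrite {2}dx0 linearBr /= symmetric_formC form_d_dx // F // gramZ_0 //=.
  by rewrite gramZ_id //; apply: sub0r.
- exact: F.
- by rewrite symmetric_formC F // gramZC.
Qed.

Let z (k : int) : dual K h := eps + k%:~R *: d.

Let flip_z k : d - z k = - z (k - 1).
Proof. by rewrite /z rmorphB /= scalerBl scale1r addrA opprB. Qed.

Let flip_zN k : d - - z k = z (k + 1).
Proof. by rewrite /z rmorphD /= scalerDl scale1r opprK addrCA [d + _]addrC. Qed.

Let unit_z k : unit_orthogonal form 0 n dx (z k).
Proof.
split=> [|j jn]; rewrite /z.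
  rewrite linearDl !linearDr /= linearZr_LR /= !linearZl_LR /= form_epseps.
  by rewrite linearZr_LR /= form_epsd form_deps form_dd !mulr0 !addr0.
by rewrite linearDl /= linearZl_LR /= form_eps_dx // form_d_dx // mulr0 addr0.
Qed.

(* The spine is an infinite sequence of passages of length [n] in which the vector [e] inserted
   between the [dx j] moves alternately from right to left ([q] even) and from left to right
   ([q] odd); at each turn two adjacent labels are exchanged and [e] is replaced by [- e] or
   [d - e].  The [4 * t + q]-th passage, [q < 4], starts at the vertex of index
   [(4 * t + q) * n]. *)
Let ea (q : nat) (t : int) : dual K h :=
  match q with
  | 0 => - z (2 * t) | 1 => z (2 * t + 1) | 2 => - z (2 * t + 1) | _ => z (2 * t + 2)
  end%N.
Let la (q : nat) : bool := (q == 1%N) || (q == 2%N).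
Let lb (q : nat) : bool := (q < 2)%N.
Let pos (q k : nat) : nat := if odd q then k.+1 else (n.+1 - k)%N.

Let passage q t k v := chain form 0 n dx (x \o swap_ends n (la q) (lb q)) (ea q t) (pos q k) v.

Let left_ok a : left_end 0 n a. Proof. by []. Qed.

Let unit_ea q t : unit_orthogonal form 0 n dx (ea q t).
Proof. by case: q => [|[|[|q]]] //=; apply: unit_orthogonalN. Qed.

Let next_q (q : nat) : nat := if (q < 3)%N then q.+1 else 0%N.
Let next_t (q : nat) (t : int) : int := if (q < 3)%N then t else t + 1.

Let flip_left a b e v : chain form 0 n dx (x \o swap_ends n a b) e 1 v <->
  chain form 0 n dx (x \o swap_ends n (~~ a) b) (d - e) 1 v.
Proof.
have H a' e' := @chain_flip_left _ _ form _ 0 n dx n_gt0 isT x a' b e' d v dx0 erefl n_gt1.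
split=> /H //; by rewrite negbK opprB addrCA subrr addr0.
Qed.

Let flip_right a b e v : chain form 0 n dx (x \o swap_ends n a b) e n.+1 v <->
  chain form 0 n dx (x \o swap_ends n a (~~ b)) (- e) n.+1 v.
Proof.
have H b' e' := @chain_flip_right _ _ form _ 0 n dx n_gt0 isT x a b' e' v dx_last (@left_ok a).
split=> /H //; by rewrite negbK opprK.
Qed.

(** The exchange is on the left after an even passage and on the right after an odd one: ([la],
    [lb]) runs through (false, true), (true, true), (true, false), (false, false) and starts
    again. *)
Let passage_next q t v : (q < 4)%N -> passage q t n v <-> passage (next_q q) (next_t q t) 0 v.
Proof.
have pE : (n.+1 - n = 1)%N by lia.
case: q => [|[|[|[|//]]]] _; rewrite /passage /next_q /next_t /pos /= ?pE ?subn0.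
- by rewrite flip_left flip_zN.
- by rewrite flip_right.
- by rewrite flip_left flip_zN -addrA.
- rewrite flip_right (_ : 2 * (t + 1) = 2 * t + 2) //; ring.
Qed.

(** A multiple of [n] has two representations, with [k = n] and with [k = 0]; [passage_next]
    identifies them. *)
Let at_index i v : Prop := exists t q k,
  [/\ (q < 4)%N, (k <= n)%N, i = (4 * t + q%:Z) * n%:Z + k%:Z & passage q t k v].

(** From this representation a step forward stays in the same passage; [at_index_gt] serves for a
    step backward. *)
Let at_index_lt i v : at_index i v -> exists t q k,
  [/\ (q < 4)%N, (k < n)%N, i = (4 * t + q%:Z) * n%:Z + k%:Z & passage q t k v].
Proof.
move=> [t [q [k [q4 kn iE vc]]]].
have [kn'|kn'] := ltnP k n; first by exists t, q, k.
have ? : k = n by lia.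
subst k; move/(passage_next t v q4): vc => vc.
exists (next_t q t), (next_q q), 0%N; split=> //; first by rewrite /next_q; case: ifP.
rewrite iE /next_t /next_q; case: ifP => q3; first by lia.
have -> : q = 3%N by lia.
lia.
Qed.

Let at_index_gt i v : at_index i v -> exists t q k,
  [/\ (q < 4)%N, (0 < k <= n)%N, i = (4 * t + q%:Z) * n%:Z + k%:Z & passage q t k v].
Proof.
move=> [t [q [k [q4 kn iE vc]]]].
have [k0|k0] := posnP k; last by exists t, q, k; split=> //; lia.
subst k; have [q0|q0] := posnP q.
  subst q; exists (t - 1), 3%N, n; split=> //; [lia|lia|].
  by apply/passage_next => //; rewrite /next_t /next_q /= subrK.
case: q q0 q4 iE vc => // q _ q4 iE vc; exists t, q, n; split=> //; [lia|lia|lia|].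
have q4' : (q < 4)%N by lia.
apply/(passage_next t v q4').
have q3 : (q < 3)%N by lia.
by rewrite /next_t /next_q q3.
Qed.

(** In two representations of an index, [k] and [k'] differ by at most [n], so the passages are
    equal, or consecutive and meeting at this index. *)
Let at_index_passage t q k v : (q < 4)%N -> (k <= n)%N ->
  at_index ((4 * t + q%:Z) * n%:Z + k%:Z) v -> passage q t k v.
Proof.
move=> q4 kn [t' [q' [k' [q4' kn' E vc]]]].
have EQ : ((4 * t' + q'%:Z) - (4 * t + q%:Z)) * n%:Z = k%:Z - k'%:Z by lia.
have [E0|[E0|E0]] : (4 * t' + q'%:Z) - (4 * t + q%:Z) = 0 \/
    (4 * t' + q'%:Z) - (4 * t + q%:Z) = 1 \/ (4 * t' + q'%:Z) - (4 * t + q%:Z) = -1.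
- nia.
- have [-> ->] : t = t' /\ q = q' by lia.
  by rewrite (_ : k = k') //; rewrite E0 in EQ; lia.
- rewrite E0 in EQ; have [kE k'E] : k = n /\ k' = 0%N by lia.
  subst k k'; apply/passage_next => //; move: vc; congr (passage _ _ _ _).
  + by rewrite /next_q; case: ifP; lia.
  + by rewrite /next_t; case: ifP; lia.
- rewrite E0 in EQ; have [kE k'E] : k = 0%N /\ k' = n by lia.
  subst k k'; move: vc => /passage_next => /(_ q4'); congr (passage _ _ _ _).
  + by rewrite /next_q; case: ifP; lia.
  + by rewrite /next_t; case: ifP; lia.
Qed.

Let at_index_intro t q k i v : (q < 4)%N -> (k <= n)%N ->
  i = (4 * t + q%:Z) * n%:Z + k%:Z -> passage q t k v -> at_index i v.
Proof. by move=> q4 kn iE vc; exists t, q, k. Qed.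

Let pos_bounds q k : (k <= n)%N -> (1 <= pos q k <= n.+1)%N.
Proof. by rewrite /pos; case: ifP; lia. Qed.

Let labels q : labelling 0 n (x \o swap_ends n (la q) (lb q)).
Proof. by apply: labelling_swap. Qed.

(** The first two outcomes of [chain_step] change [k] by one, in a direction given by the parity of
    [q]. The last two occur at turns and lead to the neighbouring passage, one step away from the
    turn. *)
Let at_index_isotropic i v y : at_index i v -> isotropic v y ->
  at_index (i + 1) (reflexion y v) \/ at_index (i - 1) (reflexion y v).
Proof.
move=> [t [q [k [q4 kn iE vc]]]] vy.
have := chain_step n_gt0 (s := 0) isT form_dx (d := d) x_labelling (@left_ok _)
  (fun _ => n_gt1) dx_last (fun _ => dx0) (unit_ea q t) (unit_orthogonalN (unit_ea q t))
  _ (pos_bounds q kn) vc vy.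
case.
- by move: q4; case: (q) => [|[|[|[|//]]]] _ _ /=; rewrite ?flip_zN ?flip_z;
  do ?apply: unit_orthogonalN; apply: unit_z.
- case=> p1 H; case qo: (odd q); [right | left]; rewrite /pos qo in p1 H.
    by apply: (@at_index_intro t q k.-1) => //; [lia|lia|rewrite /passage /pos qo prednK //; lia].
  apply: (@at_index_intro t q k.+1) => //; [lia|lia|].
  by rewrite /passage /pos qo subSS; move: H; rewrite subSn.
- case=> p1 H; case qo: (odd q); [left | right]; rewrite /pos qo in p1 H.
    by apply: (@at_index_intro t q k.+1) => //; [lia|rewrite /passage /pos qo].
  apply: (@at_index_intro t q k.-1) => //; [lia|lia|].
  rewrite /passage /pos qo (_ : (n.+1 - k.-1 = (n.+1 - k).+1)%N) //; lia.
- case=> pE; rewrite /pos in pE; move: q4 iE pE {vc}.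
  have n1 : (n.+1 - 1 = n)%N by lia.
  have n2 : (n.-1.+1 = n)%N by lia.
  case: q => [|[|[|[|//]]]] _ -> /= pE H.
  + right; apply: (@at_index_intro (t - 1) 3 n.-1) => //; [lia|lia|].
    rewrite /passage /pos /= n2; move: H; rewrite opprK.
    by rewrite mulrBr mulr1 subrK.
  + left; apply: (@at_index_intro t 2 1) => //; [lia|].
    by rewrite /passage /pos /= n1.
  + right; apply: (@at_index_intro t 1 n.-1) => //; [lia|lia|].
    by rewrite /passage /pos /= n2; move: H; rewrite opprK.
  + left; apply: (@at_index_intro (t + 1) 0 1) => //; [lia|].
    by rewrite /passage /pos /= n1 mulrDr mulr1.
case=> pE _; rewrite /pos in pE; move: q4 iE pE {vc}.
have n2 : (n.+1 - n.-1 = 2)%N by lia.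
case: q => [|[|[|[|//]]]] _ -> /= pE H.
+ left; apply: (@at_index_intro t 1 1) => //; [lia|].
  by rewrite /passage /pos /=; move: H; rewrite flip_zN.
+ right; apply: (@at_index_intro t 0 n.-1) => //; [lia|lia|].
  by rewrite /passage /pos /= n2; move: H; rewrite flip_z addrK.
+ left; apply: (@at_index_intro t 3 1) => //; [lia|].
  by rewrite /passage /pos /=; move: H; rewrite flip_zN -addrA.
+ right; apply: (@at_index_intro t 2 n.-1) => //; [lia|lia|].
  by rewrite /passage /pos /= n2; move: H; rewrite flip_z -addrA.
Qed.

Let at_index_succ i v : at_index i v -> exists2 y, isotropic v y & at_index (i + 1) (reflexion y v).
Proof.
move=> /at_index_lt[t [q [k [q4 kn iE vc]]]]; rewrite iE; case qo: (odd q).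
  have [|v1 v2] := chain_up n_gt0 (s := 0) isT form_dx (labels q) (unit_ea q t) _ vc.
    by rewrite /pos qo; lia.
  eexists; first exact: v1; apply: (@at_index_intro t q k.+1) => //; first lia.
  by move: v2; rewrite /passage /pos qo.
have [||v1 v2] := chain_down n_gt0 (s := 0) isT form_dx (labels q) (unit_ea q t) _ _ vc.
- by rewrite /pos qo; lia.
- by rewrite /pos qo; lia.
eexists; first exact: v1; apply: (@at_index_intro t q k.+1) => //; first lia.
by move: v2; rewrite /passage /pos qo subSS subSn // ltnW.
Qed.

Let at_index_pred i v : at_index i v -> exists2 y, isotropic v y & at_index (i - 1) (reflexion y v).
Proof.
move=> /at_index_gt[t [q [k [q4 kn iE vc]]]]; rewrite iE; case qo: (odd q).
  have [||v1 v2] := chain_down n_gt0 (s := 0) isT form_dx (labels q) (unit_ea q t) _ _ vc.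
  - by rewrite /pos qo; lia.
  - by rewrite /pos qo; lia.
  eexists; first exact: v1; apply: (@at_index_intro t q k.-1) => //; [lia|lia|].
  by move: v2; rewrite /passage /pos qo prednK //; lia.
have [|v1 v2] := chain_up n_gt0 (s := 0) isT form_dx (labels q) (unit_ea q t) _ vc.
  by rewrite /pos qo; lia.
eexists; first exact: v1; apply: (@at_index_intro t q k.-1) => //; [lia|lia|].
move: v2; rewrite /passage /pos qo (_ : (n.+1 - k.-1 = (n.+1 - k).+1)%N) //; lia.
Qed.

Let at_index_D i j u v : at_index i u -> at_index j v -> D_equivalent u v ->
  exists m : int, i = j + 4 * n%:Z * m.
Proof.
move=> /at_index_lt[t [q [k [q4 kn iE uc]]]] /at_index_lt[t' [q' [k' [q4' kn' jE vc]]]] uv.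
have [pp bb aa] := chain_D n_gt0 (s := 0) isT form_dx x_labelling (@left_ok _) (@left_ok _)
  (fun _ => n_gt1) (unit_ea q t) (pos_bounds q (ltnW kn)) uc
  (unit_ea q' t') (pos_bounds q' (ltnW kn')) vc uv.
(* With [k < n], place n + 1 occurs only for [q] even and place 1 only for [q] odd, both with
   [k = 0]; there this parity and the one of [la], [lb] still known determine [q]. *)
have [qq kk] : q = q' /\ k = k'.
  have {}bb : pos q k = n.+1 \/ (lb q : nat) = lb q' by case: bb => ->; [left | right].
  have {}aa : pos q k = 1%N \/ (la q : nat) = la q' by case: aa => [[-> _]|->]; [left | right].
  move: q4 q4' pp aa bb {iE jE uc vc}; rewrite /pos /la /lb.
  by case: q => [|[|[|[|//]]]] _; case: q' => [|[|[|[|//]]]] _ /=; lia.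
exists (t - t'); rewrite iE jE qq kk; ring.
Qed.

(** The factor 2 is there because four passages carry eps + k d to eps + (k + 2) d. *)
Let T (m : int) := translation form eps d (2 * m)%:~R.

Let T_B m : {morph T m : u v / u - v}.
Proof. exact: raddfB. Qed.

Let T_dx m j : (0 <= j <= n.+1)%N -> T m (dx j) = dx j.
Proof.
move=> jn; rewrite /T /translation symmetric_formC form_eps_dx //.
by rewrite mulr0 scale0r addr0.
Qed.

Let form_z_eps k : form (z k) eps = 1.
Proof. by rewrite /z linearDl /= linearZl_LR /= form_epseps form_deps mulr0 addr0. Qed.

Let form_z_d k : form (z k) d = 0.
Proof. by rewrite /z linearDl /= linearZl_LR /= form_epsd form_dd mulr0 addr0. Qed.

Let T_z m k : T m (z k) = z (k + 2 * m).
Proof.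
by rewrite /T /translation form_z_eps mulr1 /z -addrA -scalerDl -rmorphD.
Qed.

Let T_ea m q t : T m (ea q t) = ea q (t + m).
Proof.
have TN u : T m (- u) = - T m u by exact: raddfN.
case: q => [|[|[|q]]] /=; rewrite ?TN T_z.
- by rewrite -mulrDr.
- by rewrite addrAC -mulrDr.
- by rewrite addrAC -mulrDr.
- by rewrite addrAC -mulrDr.
Qed.

(** Adding [4 * n * m] to the index only replaces [t] by [t + m]: labels and place are kept and the
    inserted vector undergoes [T m], so [chain_map] applies. *)
Let at_index_translate i m u v : at_index i u ->
  at_index (i + 4 * n%:Z * m) v <->
  (forall x, rd_b v x = T m (rd_b u x)) /\ rd_p v = rd_p u /\ gram_cartan form v.
Proof.
move=> [t [q [k [q4 kn iE uc]]]].
have E : i + 4 * n%:Z * m = (4 * (t + m) + q%:Z) * n%:Z + k%:Z by rewrite iE; ring.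
have H := chain_map n_gt0 (s := 0) isT v (labels q) (T_B m) (T_dx m)
  (T_ea m q t) (pos_bounds q kn) uc.
split=> [|/H vc]; first by rewrite E => /(at_index_passage q4 kn) /H.
by apply: (@at_index_intro (t + m) q k).
Qed.

(** Orthogonality to [d] makes [T m] isometric on the roots and lets [s_s] apply on [Vb v]. *)
Let at_index_form_d i u y : at_index i u -> form (rd_b u y) d = 0.
Proof.
move=> [t [q [k [q4 kn iE [ub _ _]]]]].
have ed : form (ea q t) d = 0.
  by case: (q) => [|[|[|q']]] /=; rewrite ?linearNl /= form_z_d ?oppr0.
move: y; apply: (labelling_ind (labels q)) => j jn; rewrite ub // linearBl /=.
have F j' : (j' <= n.+2)%N -> form (insert dx (ea q t) (pos q k) j') d = 0.
  have := pos_bounds q kn; rewrite /insert => pn jn'.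
  case: ltnP => jp; first by rewrite symmetric_formC form_d_dx //; lia.
  by case: eqP => [//|jp']; rewrite symmetric_formC form_d_dx //; lia.
by rewrite !F ?subr0 //; lia.
Qed.

(** Such a root is moved by [T m] for every nonzero [m]; the root that starts at the inserted vector
    is one. *)
Let at_index_form_eps i u : at_index i u -> exists y, form (rd_b u y) eps != 0.
Proof.
move=> [t [q [k [q4 kn iE [ub _ _]]]]]; have pn := pos_bounds q kn.
exists ((x \o swap_ends n (la q) (lb q)) (pos q k)); rewrite ub; last by lia.
rewrite insert_id insert_gt // linearBl /= [form (dx _) _]symmetric_formC form_eps_dx; last by lia.
rewrite subr0; case: (q) => [|[|[|q']]] /=; rewrite ?linearNl /= form_z_eps.
all: by rewrite ?oppr_eq0 oner_neq0.
Qed.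

Let d_neq0 : d != 0.
Proof.
have [/andP[_ ff] _ _ _ _] := v0C.
by apply: (free_not0 ff); rewrite in_cons mem_cat mem_head !orbT.
Qed.

Let v0_gram : gram_cartan form v0. Proof. by case: v0C => _ _ _ _ []. Qed.

(** No label is exchanged at [v0] and [eps] is at place n + 1; this ends passage 3 for t = -1, at
    index (-4 + 3) n + n = 0. *)
Let v0_chain : passage 3 (-1) n v0.
Proof.
have [_ _ _ vb [vp vg]] := v0C.
have -> : passage 3 (-1) n = chain form 0 n dx (x \o swap_ends n false false) eps n.+1.
  by rewrite /passage /= /z (_ : 2 * -1 + 2 = 0) // scale0r addr0.
split=> // j /andP[_ jn]; rewrite /= /swap_ends /= /x.
- rewrite vb inordK //.
  have [->|[jE|[->|->]]] : j = 0%N \/ (0 < j < n)%N \/ j = n \/ j = n.+1 by lia.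
  + by rewrite !insert_lt // dx0 dx1 eqxx scaler_nat mulr2n opprD addrA.
  + have [j0 jn'] := andP jE.
    rewrite (gtn_eqF j0) /C_root jn' !insert_lt ?ltnS ?(ltnW jn') // /dx /with_ends.
    by rewrite (gtn_eqF j0) /= eqSS !ltn_eqF // ltnW.
  + rewrite (gtn_eqF n_gt0) /C_root ltnn eqxx insert_lt // insert_id /dx /with_ends.
    by rewrite (gtn_eqF n_gt0) ltn_eqF.
  + rewrite /C_root ltnNge leqnSn gtn_eqF //= gtn_eqF // insert_id insert_gt // /dx /with_ends /=.
    by rewrite eqxx opprK addrC.
- rewrite vp inordK // /C_parity; case: ifP => jE.
    by rewrite (_ : _ || _ = false) //; lia.
  by rewrite (_ : _ || _ = true) //; lia.
Qed.

Let at_index_v0 : at_index 0 v0.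
Proof. by apply: (@at_index_intro (-1) 3 n) => //; lia. Qed.

Let at_index_exists i : exists u, spine v0 u /\ at_index i u.
Proof.
have up (k : nat) : exists u, spine v0 u /\ at_index k%:Z u.
  elim: k => [|k [u [us uk]]]; first by exists v0; split=> //; apply: spine_refl.
  have [y uy uk'] := at_index_succ uk; exists (reflexion y u); split.
    exact: spine_trans us (spine_step uy).
  by rewrite -addn1 PoszD.
have down (k : nat) : exists u, spine v0 u /\ at_index (- k%:Z) u.
  elim: k => [|k [u [us uk]]]; first by exists v0; split=> //; apply: spine_refl.
  have [y uy uk'] := at_index_pred uk; exists (reflexion y u); split.
    exact: spine_trans us (spine_step uy).
  by rewrite -addn1 PoszD opprD.
by case: i => k; [apply: up | rewrite NegzE; apply: down].
Qed.

Let spine_st u : spine v0 u -> exists i, at_index i u.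
Proof.
move: u; apply: spine_ind => [|u y _ [i ui] uy]; first by exists 0.
by have [?|?] := at_index_isotropic ui uy; [exists (i + 1) | exists (i - 1)].
Qed.

Let T0 nu : T 0 nu = nu.
Proof. by rewrite /T /translation mul0r scale0r addr0. Qed.

Let at_index_inj i u v : spine v0 u -> spine v0 v -> at_index i u -> at_index i v -> u = v.
Proof.
move=> us vs ui vi; have := (at_index_translate 0 v ui).1.
rewrite mulr0 addr0 => /(_ vi)[vb [vp _]].
by apply: gram_spine_inj v0_gram us vs _ _ => y; rewrite ?vb ?T0 ?vp.
Qed.

Let s_s nu : form nu d = 0 ->
  iter 2 (s_ form eps \o s_ form (d - 2 *: eps)) nu = T 1 nu.
Proof.
have norm : form (d - 2 *: eps) (d - 2 *: eps) = 4.
  rewrite linearBl /= !linearBr /= !linearZr_LR /= !linearZl_LR /=.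
  by rewrite form_dd form_deps form_epsd form_epseps; ring.
(* The product of the two reflections is already a translation; squaring doubles it because [d] is
   orthogonal to [eps]. *)
have once u : form u d = 0 -> s_ form eps (s_ form (d - 2 *: eps) u) = u + form u eps *: d.
  move=> ud; rewrite /s_ norm form_epseps divr1 linearBl /= linearZl_LR /=.
  rewrite !linearBr /= !linearZr_LR /= ud linearBl /= linearZl_LR /= form_deps form_epseps.
  set c := form u eps.
  have -> : 2 * (0 - 2 * c) / 4 = - c by field.
  have -> : 2 * (c - - c * (0 - 2 * 1)) = - (2 * c) by ring.
  rewrite !scaleNr !opprK scalerBr scalerA (mulrC c).
  by rewrite -addrA subrK.
move=> nd; rewrite /= (once nu nd) once; last first.
  by rewrite linearDl /= linearZl_LR /= nd form_dd mulr0 addr0.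
rewrite linearDl /= linearZl_LR /= form_deps mulr0 addr0 -addrA -scalerDl.
by rewrite /T /translation mulr1 mulr2n mulrDl mul1r.
Qed.

Lemma spine_C1 : exists vs : int -> root_datum 'I_n.+2 h,
  [/\ spine_indexed_by v0 vs, vs 0 = v0,
      vs 1 = reflexion (inord n.+1) v0,
      vs (-1) = reflexion (inord n) v0
    & forall v, spine v0 v ->
      exists u, [/\ spineD v u,
        infinite_cyclic_group_gen (sk_op v) v (spineD v) u,
        {in Vb v, sigma_b v u =1
           iter 2 (s_ form eps \o s_ form (d - 2 *: eps))}
      & forall i : int, sigma v u (vs i) = vs (i + (4 * n)%:Z)]].
Proof.
have [vs vsP] := choice at_index_exists.
have vsS i : spine v0 (vs i) by case: (vsP i).
have vs_st i : at_index i (vs i) by case: (vsP i).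
have vsE i u : spine v0 u -> at_index i u -> u = vs i.
  by move=> us ui; apply: at_index_inj ui (vs_st i).
have vsT i m y : rd_b (vs (i + 4 * n%:Z * m)) y = T m (rd_b (vs i) y).
  by have [-> _] := (at_index_translate m _ (vs_st i)).1 (vs_st _).
have vs_tw i m : exists f, intertwined (fun=> 1) f (T m) (vs i) (vs (i + 4 * n%:Z * m)).
  have [f fE] := linear_extension (rd_a (vs (i + 4 * n%:Z * m))) (rd_a_free (vs i)).
  have [_ [pE g]] := (at_index_translate m _ (vs_st i)).1 (vs_st _).
  exists f; split=> // [y|y|y y']; first exact: oner_neq0.
    by rewrite scale1r fE.
  rewrite mul1r g (gram_spine v0_gram (vsS i)) !vsT.
  by rewrite form_translation // (at_index_form_d _ (vs_st i)).
(* Equal vertices are D-equivalent, so their indices differ by [4 * n * m]; then [T m] fixes every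
   root, including one not orthogonal to [eps], whence [m = 0]. *)
have vs_inj : injective vs.
  move=> i j ij; have := vs_st i; rewrite ij => jst.
  have [m mE] := at_index_D jst (vs_st j) (D_equivalent_refl _).
  have [y ye] := at_index_form_eps (vs_st j).
  have := vsT j m y; rewrite -mE ij /T /translation => /eqP.
  rewrite -subr_eq0 opprD addrA subrr add0r oppr_eq0 scaler_eq0 (negPf d_neq0) orbF.
  rewrite mulf_eq0 (negPf ye) orbF intr_eq0 => m0.
  by rewrite mE (_ : m = 0) ?mulr0 ?addr0 //; lia.
have vs0 : vs 0 = v0 by rewrite -(vsE 0 v0) //; apply: spine_refl.
have n1 : (n.+1 - 1 = n)%N by lia.
have step (i : int) y : isotropic v0 y -> at_index i (reflexion y v0) -> vs i = reflexion y v0.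
  by move=> v0y ist; rewrite (vsE i (reflexion y v0)) //; apply: spine_step.
have swn b : x (swap_ends n false b n) = inord (if b then n.+1 else n).
  rewrite /x /swap_ends /=; case: b => //=.
  by rewrite leqnn leqnSn /= addKn.
exists vs; split=> //.
- split=> //.
    apply/seteqP; split=> [_ [i _ <-] //|u us].
    by have [i ui] := spine_st us; exists i => //; rewrite (vsE i u).
  have succ i : spine_edge (vs i) (vs (i + 1)).
    have [y iy yst] := at_index_succ (vs_st i); exists y; split=> //.
    by rewrite -(vsE _ _ _ yst) //; apply: spine_trans (vsS i) (spine_step iy).
  have pred i : spine_edge (vs i) (vs (i - 1)).
    have [y iy yst] := at_index_pred (vs_st i); exists y; split=> //.
    by rewrite -(vsE _ _ _ yst) //; apply: spine_trans (vsS i) (spine_step iy).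
  move=> i j; split=> [[y [iy yE]]|ij].
    have rs : spine v0 (reflexion y (vs i)) := spine_trans (vsS i) (spine_step iy).
    by have [/(vsE _ _ rs)|/(vsE _ _ rs)] := at_index_isotropic (vs_st i) iy;
      rewrite -yE => /vs_inj ->; lia.
  have [->|->] : j = i + 1 \/ j = i - 1 by lia.
    exact: succ.
  exact: pred.
(* As the start of passage 0, [v0] has its last two labels exchanged, so the move to place [n]
   reflects in label n + 1; as the end of passage 3, the same move reflects in label n. *)
- have vc : chain form 0 n dx (x \o swap_ends n false true) (- z 0) n.+1 v0.
    have E : (4 * 0 + 0%:Z) * n%:Z + 0%:Z = 0 :> int by ring.
    have := @at_index_passage 0 0%N 0%N v0 isT (leq0n _); rewrite E => /(_ at_index_v0).
    by rewrite /passage /pos /= mulr0 subn0.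
  have [||v1 v2] := chain_down n_gt0 (s := 0) isT form_dx
    (labelling_swap n_gt0 (s := 0) isT true x_labelling (@left_ok _))
    (unit_orthogonalN (unit_z 0)) _ _ vc; [lia|lia|].
  move: v1 v2; rewrite /= swn => v1 v2; apply: step => //.
  by apply: (@at_index_intro 0 0 1) => //; rewrite /passage /pos /= n1.
- have [||v1 v2] := chain_down n_gt0 (s := 0) isT form_dx
    (labels 3) (unit_ea 3 (-1)) _ _ v0_chain; [rewrite /pos /=; lia|rewrite /pos /=; lia|].
  move: v1 v2; rewrite /= swn => v1 v2; apply: step => //.
  apply: (@at_index_intro (-1) 3 n.-1) => //; [lia|lia|].
  by rewrite /passage /pos /= prednK.
move=> v /[dup] /spine_st[j vj] /vsE /(_ vj) -> {v vj}.
have D m : D_equivalent (vs (j + 4 * n%:Z * m)) (vs j).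
  by have [f tw] := vs_tw j m; apply: intertwined_D tw.
have S i : spine (vs j) (vs i) by apply: spine_trans (spine_sym (vsS j)) (vsS i).
have SD m : spineD (vs j) (vs (j + 4 * n%:Z * m)) by apply/spineDP.
have SDP u : spineD (vs j) u -> exists m, u = vs (j + 4 * n%:Z * m).
  move=> /spineDP[ju uD]; have us := spine_trans (vsS j) ju.
  have [i ui] := spine_st us; have [m mE] := at_index_D ui (vs_st j) uD.
  by exists m; rewrite -mE; apply: vsE.
(* A path from [vs j] to [vs i], started at the translate of [vs j], ends at a vertex with roots
   [T m] of those of [vs i]; [at_index_translate] gives its index. *)
have sig m i : sigma (vs j) (vs (j + 4 * n%:Z * m)) (vs i) = vs (i + 4 * n%:Z * m).
  have [s [js sE]] := S i; have [f tw] := vs_tw j m.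
  rewrite -[vs i in LHS]sE sigma_walk //; last exact: isotropic_reflectable.
  have ws : spine (vs (j + 4 * n%:Z * m)) (walk (vs (j + 4 * n%:Z * m)) s).
    exists s; split=> //.
    exact: intertwined_along (fun u' v' y => @intertwined_isotropic _ _ _ _ _ _ u' v' y) tw js.
  have {}ws := spine_trans (vsS _) ws.
  have [_ _ bE pE _] := intertwined_walk s tw; rewrite sE in bE pE.
  by apply: vsE => //; apply/(at_index_translate m _ (vs_st i)); split=> //; split=> //;
    apply: gram_spine v0_gram ws.
have four : (4 * n)%:Z = 4 * n%:Z * 1 by rewrite PoszM mulr1.
exists (vs (j + 4 * n%:Z * 1)); split=> //; last by move=> i; rewrite sig four.
- split=> //; first exact: spineD_group.
    have f_inj : injective (fun m : int => vs (j + 4 * n%:Z * m)).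
      by move=> m m' /vs_inj/addrI/mulfI; apply; rewrite mulf_neq0 //; lia.
    have k_inj : injective (fun k : nat => vs (j + 4 * n%:Z * k%:Z)).
      by move=> k l /f_inj[].
    move=> /(finite_preimage (fun k l _ _ => @k_inj k l)) fin.
    by apply: infinite_nat; apply: sub_finite_set fin => k _; apply: SD.
  move=> H [HG H1 HM HV] Hu; apply/seteqP; split=> // u /SDP[m ->].
  (* Multiplying by the generator adds one to the multiple of 4n: nonnegative multiples come by
     induction, negative ones as their inverses. *)
  have up (k : nat) : H (vs (j + 4 * n%:Z * k%:Z)).
    elim: k => [|k IH]; first by rewrite mulr0 addr0.
    have := HM _ _ Hu IH; rewrite /sk_op sig -addrA -mulrDr.
    by rewrite -[k.+1]addn1 PoszD.
  case: m => k; first exact: up.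
  rewrite NegzE; apply: HV (up k.+1) (SD _) _.
  by rewrite /sk_op sig -addrA -mulrDr addNr mulr0 addr0.
(* Both sides are linear on [Vb], and on each root the shift by 4n acts as [T 1], that is, as
   Psi. *)
move=> w wV; have wE := coord_span wV.
have bE (i : 'I_#|'I_n.+2|) :
    (codom_tuple (rd_b (vs j)))`_i = rd_b (vs j) (enum_val i).
  by rewrite (nth_map (enum_val i)) -?cardE // -enum_val_nth.
rewrite s_s; last first.
  rewrite wE linear_sumlz big1 // => i _.
  by rewrite bE linearZl_LR /= (at_index_form_d _ (vs_st j)) mulr0.
rewrite [w in RHS]wE /T linear_sum /= /sigma_b.
rewrite (eq_bigl (fun y => y \in 'I_n.+2)) // big_enum_val /=.
by apply: eq_bigr => i _; rewrite enum_valK vsT bE linearZ.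
Qed.

End AffineType.

Unset Implicit Arguments.

Theorem corollary8p4 (R : realType) :
  (forall (n : nat) (h : vectType R[i]) (form : {symmetric (dual R[i] h)})
      (eps : dual R[i] h) (dl : nat -> dual R[i] h)
      (v0 : root_datum 'I_n.+1 h),
    (1 <= n)%N -> type_C form eps dl v0 ->
    forall v, spine v0 v -> trivial_group (sk_op v) v (spineD v))
  /\
  (forall (n : nat) (h : vectType R[i]) (form : {symmetric (dual R[i] h)})
      (eps : dual R[i] h) (dl : nat -> dual R[i] h) (d L0 : dual R[i] h)
      (v0 : root_datum 'I_n.+2 h),
    (1 < n)%N -> type_C1 form eps dl d L0 v0 ->
    exists vs : int -> root_datum 'I_n.+2 h,
      [/\ spine_indexed_by v0 vs, vs 0 = v0,
          vs 1 = reflexion (inord n.+1) v0,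
          vs (-1) = reflexion (inord n) v0
        & forall v, spine v0 v ->
          exists u, [/\ spineD v u,
            infinite_cyclic_group_gen (sk_op v) v (spineD v) u,
            {in Vb v, sigma_b v u =1
               iter 2 (s_ form eps \o s_ form (d - 2 *: eps))}
          & forall i : int, sigma v u (vs i) = vs (i + (4 * n)%:Z)]]).
Proof.
split=> [n h form eps dl v0 n_gt0 v0C v|n h form eps dl d L0 v0 n_gt1 v0C].
  exact: spineD_C n_gt0 v0C v.
exact: spine_C1 n_gt1 v0C.
Qed.
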